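(* Let $(M,g,J)$ be a QCH Kähler manifold with respect to a distribution $\mathcal{D}$. Then $(M,g,J)$ is holomorphically pseudosymmetric. More precisely, if the curvature tensor of $(M,g,J)$ is $R=a\Pi+b\Phi+c\Psi$, where $a,b,c\in C^\infty(M)$ and $\Pi,\Phi,\Psi$ are the Kähler-type curvature tensors determined by $g$, $J$ and $\mathcal{D}$, then $$R.R=\left(a+\tfrac{b}{2}\right)\Pi.R .$$
   Context: Conventions. $(M,g,J)$ is a Kähler manifold of real dimension $2n$ with Levi-Civita connection $\nabla$. The curvature tensor is $R(X,Y)Z=([\nabla_X,\nabla_Y]-\nabla_{[X,Y]})Z$, and $(1,3)$ tensors are identified with $(0,4)$ tensors by $R(X,Y,Z,W)=g(R(X,Y)Z,W)$. QCH Kähler manifold. $(M,g,J)$ is a QCH Kähler manifold if it admits a smooth, two-dimensional (real rank 2), $J$-invariant distribution $\mathcal{D}\subset TM$ such that for every $J$-invariant 2-plane $\pi\subset T_xM$, the holomorphic curvature $K(\pi)=R(X,JX,JX,X)$, where $X\in\pi$ and $g(X,X)=1$, depends only on the point $x$ and the number $|X_{\mathcal D}|=\sqrt{g(X_{\mathcal D},X_{\mathcal D})}$, where $X_{\mathcal D}$ is the orthogonal projection of $X$ on $\mathcal{D}$. Then $R(X,JX,JX,X)=\phi(x,|X_{\mathcal D}|)$ with $\phi(x,t)=a(x)+b(x)t^2+c(x)t^4$ for smooth functions $a,b,c$ on $M$. It is a known result (Ganchev–Mihova) that the curvature tensor of a QCH Kähler manifold is of the form $R=a\Pi+b\Phi+c\Psi$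 with $a,b,c\in C^\infty(M)$. The tensors $\Pi,\Phi,\Psi$. Let $p_{\mathcal D}:TM\to\mathcal{D}$ be the orthogonal projection, $h(X,Y)=g(p_{\mathcal D}X,p_{\mathcal D}Y)$ and $\omega(X,Y)=h(JX,Y)$. Then $$\Pi(X,Y,Z,U)=\tfrac14\big(g(Y,Z)g(X,U)-g(X,Z)g(Y,U)+g(JY,Z)g(JX,U)-g(JX,Z)g(JY,U)-2g(JX,Y)g(JZ,U)\big),$$ $$\begin{aligned}\Phi(X,Y,Z,U)=\tfrac18\big(&g(Y,Z)h(X,U)-g(X,Z)h(Y,U)+g(X,U)h(Y,Z)-g(Y,U)h(X,Z)\\&+g(JY,Z)\omega(X,U)-g(JX,Z)\omega(Y,U)+g(JX,U)\omega(Y,Z)-g(JY,U)\omega(X,Z)\\&-2g(JX,Y)\omega(Z,U)-2g(JZ,U)\omega(X,Y)\big),\end{aligned}$$ $$\Psi(X,Y,Z,U)=-\omega(X,Y)\omega(Z,U).$$ Derivation action. For a curvature-like tensor $S$ (for instance $S=R$ or $S=\Pi$), with $S(U,V)$ the endomorphism of $TM$ defined by $g(S(U,V)X,W)=S(U,V,X,W)$, and a $(0,4)$ tensor $T$, $S.T$ is the tensor obtained by letting $S(U,V)$ act on $T$ as a derivation of the tensor algebra: $$(S(U,V).T)(X_1,X_2,X_3,X_4)=-\sum_{i=1}^4T(X_1,\dots,S(U,V)X_i,\dots,X_4).$$ Holomorphically pseudosymmetric. A Kähler manifold $(M,g,J)$ is called holomorphically pseudosymmetric if $R.R=f\,\Pi.R$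 for some smooth function $f\in C^\infty(M)$. *)

(* Defs.v *)
From HB Require Import structures.
From mathcomp Require Import all_boot all_order all_algebra.
From mathcomp Require Import all_classical all_reals all_analysis.
Set Implicit Arguments.
Unset Strict Implicit.
Unset Printing Implicit Defensive.
Import Order.TTheory GRing.Theory Num.Theory.
Import numFieldNormedType.Exports.
Local Open Scope classical_set_scope.
Local Open Scope ring_scope.

(* [f] is of class C^k on the open set [U]. *)
Fixpoint class_C (R : realType) (m k : nat) (U : set 'rV[R]_m)
    (f : 'rV[R]_m -> R) : Prop :=
  match k with
  | 0 => forall x, U x -> {for x, continuous f}
  | k'.+1 => (forall x, U x -> differentiable f x) /\
             forall v, class_C k' U (fun x => 'D_v f x)
  end.

Definition smooth_on (R : realType) (m : nat) (U : set 'rV[R]_m)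
    (f : 'rV[R]_m -> R) : Prop := forall k, class_C k U f.

(* Smooth m-manifolds: Hausdorff, second countable, with a smooth atlas.  The
   atlas is indexed by the points of the manifold: [chart x] is a chart around
   [x], with domain [dom x] and inverse [chart_inv x].  Any smooth atlas gives
   such a family, defining the same smooth structure, by choosing one of its
   charts around each point. *)
Record manifold (R : realType) (m : nat) := Manifold {
  carrier :> topologicalType ;
  dom : carrier -> set carrier ;
  chart : carrier -> carrier -> 'rV[R]_m ;
  chart_inv : carrier -> 'rV[R]_m -> carrier ;
  manifold_hausdorff : hausdorff_space carrier ;
  manifold_countable : @second_countable carrier ;
  open_dom : forall x, open (dom x) ;
  mem_dom : forall x, dom x x ;
  open_codom : forall x, open (chart x @` dom x) ;
  chartK : forall x y, dom x y -> chart_inv x (chart x y) = y ;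
  chart_continuous : forall x y, dom x y -> {for y, continuous (chart x)} ;
  chart_inv_continuous : forall x p,
    (chart x @` dom x) p -> {for p, continuous (chart_inv x)} ;
  transition_smooth : forall x y (i : 'I_m),
    smooth_on (chart x @` (dom x `&` dom y))
              (fun p => chart y (chart_inv x p) 0 i) }.

Arguments dom {R m} M x : rename.
Arguments chart {R m} M x y : rename.
Arguments chart_inv {R m} M x p : rename.

Section Fields.
Context {R : realType} {m : nat} {M : manifold R m}.

Definition smooth (f : M -> R) : Prop :=
  forall x, smooth_on (chart M x @` dom M x) (f \o chart_inv M x).

(* T_x M is represented by R^m through the chart [chart M x]: the vector
   [v : 'rV_m] stands for sum_i v_i d/dx^i at [x], where x^1, ..., x^m are the
   coordinates of [chart M x]. *)
Definition tderive (x : M) (v : 'rV[R]_m) (f : M -> R) : R :=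
  'D_v (f \o chart_inv M x) (chart M x x).

Definition vfield : Type := M -> 'rV[R]_m.

Definition fderive (X : vfield) (f : M -> R) : M -> R :=
  fun x => tderive x (X x) f.

Definition smooth_vfield (X : vfield) : Prop :=
  forall f, smooth f -> smooth (fderive X f).

(* [X, Y] is the smooth vector field with [X, Y] f = X (Y f) - Y (X f). *)
Definition is_bracket (X Y Z : vfield) : Prop :=
  smooth_vfield Z /\ forall f, smooth f -> forall x,
    fderive Z f x = fderive X (fderive Y f) x - fderive Y (fderive X f) x.

Definition bracket (X Y : vfield) : vfield :=
  xget ((fun=> 0) : vfield) [set Z | is_bracket X Y Z].

(* A smooth vector field with value [u] at [x]. *)
Definition extension (x : M) (u : 'rV[R]_m) : vfield :=
  xget ((fun=> 0) : vfield) [set X | smooth_vfield X /\ X x = u].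

(* The value on u, v of the bilinear form with Gram matrix [G x]. *)
Definition inner (G : M -> 'M[R]_m) (x : M) (u v : 'rV[R]_m) : R :=
  (u *m G x *m v^T) 0 0.

Record riemannian (G : M -> 'M[R]_m) : Prop := Riemannian {
  riem_sym : forall x u v, inner G x u v = inner G x v u ;
  riem_pos : forall x u, u != 0 -> 0 < inner G x u u ;
  riem_smooth : forall X Y, smooth_vfield X -> smooth_vfield Y ->
    smooth (fun x => inner G x (X x) (Y x)) }.

Record levi_civita (G : M -> 'M[R]_m)
    (nabla : vfield -> vfield -> vfield) : Prop := LeviCivita {
  nabla_smooth : forall X Y, smooth_vfield X -> smooth_vfield Y ->
    smooth_vfield (nabla X Y) ;
  nabla_linear_l : forall f X Y Z, smooth f ->
    smooth_vfield X -> smooth_vfield Y -> smooth_vfield Z -> forall x,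
    nabla (fun y => f y *: X y + Y y) Z x = f x *: nabla X Z x + nabla Y Z x ;
  nabla_additive_r : forall X Y Z,
    smooth_vfield X -> smooth_vfield Y -> smooth_vfield Z -> forall x,
    nabla X (fun y => Y y + Z y) x = nabla X Y x + nabla X Z x ;
  nabla_leibniz : forall f X Y, smooth f ->
    smooth_vfield X -> smooth_vfield Y -> forall x,
    nabla X (fun y => f y *: Y y) x = fderive X f x *: Y x + f x *: nabla X Y x ;
  nabla_torsion_free : forall X Y, smooth_vfield X -> smooth_vfield Y ->
    is_bracket X Y (fun x => nabla X Y x - nabla Y X x) ;
  nabla_metric : forall X Y Z,
    smooth_vfield X -> smooth_vfield Y -> smooth_vfield Z -> forall x,
    fderive X (fun y => inner G y (Y y) (Z y)) x =
    inner G x (nabla X Y x) (Z x) + inner G x (Y x) (nabla X Z x) }.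

End Fields.

Arguments vfield {R m} M.

(* Kahler manifolds of real dimension 2n.  The endomorphism [J_x] of T_x M is
   u |-> u *m J x.  The connection [nabla] is determined by the metric on
   smooth vector fields; only its values there are used. *)
Record kahler (R : realType) (n : nat) := Kahler {
  kahler_manifold :> manifold R (2 * n) ;
  gram : kahler_manifold -> 'M[R]_(2 * n) ;
  J : kahler_manifold -> 'M[R]_(2 * n) ;
  nabla : vfield kahler_manifold -> vfield kahler_manifold ->
          vfield kahler_manifold ;
  gram_riemannian : riemannian gram ;
  nabla_levi_civita : levi_civita gram nabla ;
  J_smooth : forall X : vfield kahler_manifold, smooth_vfield X ->
    smooth_vfield (fun x => X x *m J x) ;
  J_square : forall x, J x *m J x = - 1%:M ;
  J_orthogonal : forall x u v,
    inner gram x (u *m J x) (v *m J x) = inner gram x u v ;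
  J_parallel : forall X Y : vfield kahler_manifold,
    smooth_vfield X -> smooth_vfield Y -> forall x,
    nabla X (fun y => Y y *m J y) x = nabla X Y x *m J x }.

Section Curvature.
Context {R : realType} {n : nat} (K : kahler R n).
Local Notation TM := 'rV[R]_(2 * n).

Definition g (x : K) (u v : TM) : R := inner (@gram _ _ K) x u v.

(* (0,4) tensors, as functions of a point and four tangent vectors there *)
Definition tensor4 : Type := K -> TM -> TM -> TM -> TM -> R.

(* R(X,Y)Z for vector fields *)
Definition curvature_vfield (X Y Z : vfield K) : vfield K := fun x =>
  nabla X (nabla Y Z) x - nabla Y (nabla X Z) x - nabla (bracket X Y) Z x.

(* R(X,Y,Z,W) = g(R(X,Y)Z,W) at a point.  R(X,Y)Z is tensorial, so that its
   value at x does not depend on the smooth extensions of the vectors. *)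
Definition Rm : tensor4 := fun x X Y Z W =>
  g x (curvature_vfield (extension x X) (extension x Y) (extension x Z) x) W.

(* S(U,V)X: the vector with g(S(U,V)X, W) = S(U,V,X,W) for all W *)
Definition endo (S : tensor4) (x : K) (U V X : TM) : TM :=
  (\row_i S x U V X (delta_mx 0 i)) *m invmx (gram x).

Definition act (S T : tensor4) (x : K) (U V X1 X2 X3 X4 : TM) : R :=
  - (T x (endo S x U V X1) X2 X3 X4 + T x X1 (endo S x U V X2) X3 X4 +
     T x X1 X2 (endo S x U V X3) X4 + T x X1 X2 X3 (endo S x U V X4)).

Definition Pi : tensor4 := fun x X Y Z U =>
  let g := g x in let j (v : TM) := v *m J x in
  4^-1 * (g Y Z * g X U - g X Z * g Y U + g (j Y) Z * g (j X) U
          - g (j X) Z * g (j Y) U - 2 * (g (j X) Y * g (j Z) U)).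

Definition holomorphically_pseudosymmetric : Prop :=
  exists2 f : K -> R, smooth f &
    forall x U V X1 X2 X3 X4,
      act Rm Rm x U V X1 X2 X3 X4 = f x * act Pi Rm x U V X1 X2 X3 X4.

(* A distribution is a family of matrices [D x] whose row spaces are the
   subspaces of T_x M. *)
Variable D : K -> 'M[R]_(2 * n).

(* Local frames are restrictions of global vector fields, up to shrinking the
   neighbourhood. *)
Definition smooth_rank2_distribution : Prop :=
  (forall x, \rank (D x) = 2%N) /\
  forall x : K, exists E1 E2 : vfield K,
    [/\ smooth_vfield E1, smooth_vfield E2 &
        \forall y \near x, (D y == col_mx (E1 y) (E2 y))%MS].

(* u |-> u *m pD x is the projection of T_x M onto D_x along its orthogonal
   complement {u | g(u,v) = 0 for all v in D_x}. *)
Definition pD (x : K) : 'M[R]_(2 * n) :=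
  proj_mx (D x) (kermx (gram x *m (D x)^T)).

Definition h (x : K) (X Y : TM) : R := g x (X *m pD x) (Y *m pD x).

Definition omega (x : K) (X Y : TM) : R := h x (X *m J x) Y.

Definition Phi : tensor4 := fun x X Y Z U =>
  let g := g x in let h := h x in let omega := omega x in
  let j (v : TM) := v *m J x in
  8^-1 * (g Y Z * h X U - g X Z * h Y U + g X U * h Y Z - g Y U * h X Z
          + g (j Y) Z * omega X U - g (j X) Z * omega Y U
          + g (j X) U * omega Y Z - g (j Y) U * omega X Z
          - 2 * (g (j X) Y * omega Z U) - 2 * (g (j Z) U * omega X Y)).

Definition Psi : tensor4 := fun x X Y Z U => - (omega x X Y * omega x Z U).

(* The planes pi in T_x M are the row spaces of the matrices of rank 2. *)
Definition QCH : Prop :=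
  [/\ smooth_rank2_distribution,
      forall x, stablemx (D x) (J x) &
      exists phi : K -> R -> R, forall x (pi : 'M[R]_(2 * n)),
        \rank pi = 2%N -> stablemx pi (J x) ->
        forall X : TM, (X <= pi)%MS -> g x X X = 1 ->
          Rm x X (X *m J x) (X *m J x) X =
          phi x (Num.sqrt (g x (X *m pD x) (X *m pD x)))].

End Curvature.

(* Main.v *)
Require Import Defs.
From HB Require Import structures.
From mathcomp Require Import all_boot all_order all_algebra.
From mathcomp Require Import all_classical all_reals all_analysis.
From mathcomp Require Import ring lra.
Import Order.TTheory GRing.Theory Num.Theory.
Import numFieldNormedType.Exports.
Local Open Scope classical_set_scope.
Local Open Scope ring_scope.
Set Implicit Arguments.
Unset Strict Implicit.
Unset Printing Implicit Defensive.

(** Why the theorem is true.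

    Let P be the orthogonal projection on the distribution, h the restriction
    of g along P, and k = g - h.  The tensor Pi is a quadratic expression in g
    whose polarization at (g, h) is Phi.  Substituting g = h + k, the tensor
    Phi - Pi/2 becomes half the difference of the quadratic expressions in h
    and in k, with no mixed terms; so for f = a + b/2 the remainder
    S = R - f Pi = b (Phi - Pi/2) + c Psi has endomorphisms S(U,V) that are skew
    for g, commute with J and preserve the distribution.  Such a derivation
    kills g, h and their associated 2-forms, hence Pi, Phi and Psi, hence R:
    S.R = 0, which is R.R = f Pi.R ([act_pseudosymmetric]).

    To produce a, b, c from the condition on the holomorphic curvature, fix a
    point and restrict H(X) = R(X,JX,JX,X) to the plane spanned by a unit vector
    e1 of the distribution and a unit vector e2 orthogonal to it.  There H is a
    quartic form in the coordinates (s, t) which on the unit circle only depends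
    on |s|, so it is even in t and its odd coefficients vanish.  Thus H is a
    polynomial in |X_D|^2 on unit vectors ([holomorphic_split]), and R and
    a Pi + b Phi + c Psi have the same holomorphic sectional curvature.  A
    curvature tensor of Kaehler type is determined by it ([kc_polarization]);
    that Psi satisfies the Bianchi identity uses that the distribution has rank
    2, so that its 2-form is decomposable.

    The function a + b/2 is smooth because it can be read off from H:
    H(e1+e2) - H(e1) - H(e2) = (2a + b) |e1|^2 |e2|^2 for e1 in the distribution
    and e2 orthogonal to it, and near each point such e1 and e2 are values of
    smooth vector fields.  In real dimension 2 there is no e2, but there R is a
    multiple of Psi alone and f = 0 serves.

    All this takes place on the tangent spaces and presupposes that R is a
    tensor with the usual symmetries.  Since R at a point is defined through
    vector fields extending the given vectors, one needs that such extensions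
    exist and do not matter.  Both follow from a cut-off function phi with
    phi(x) = 1 supported in a chart: the cut-off coordinate fields E_i are
    globally smooth, and every smooth field X satisfies
    phi X = sum_i c_i E_i with smooth c_i ([exists_local_frame]), so that a
    C^oo-linear map on fields only sees the value X(x) ([tensorial]). *)

(** * Functions of class C^k on open subsets of R^m *)

Section NearDifferentiable.
Context {R : realType} {V W : normedModType R}.

(** Differentiability is stated with remainders that are functions on the whole
    space, so a change of [f] away from [a] has to be absorbed: the difference
    of the two functions has differential 0 at [a]. *)
Lemma near_eq_differentiable (f g : V -> W) (a : V) :
  (\forall x \near a, f x = g x) -> differentiable f a -> differentiable g a.
Proof.
move=> fg df; have fga := nbhs_singleton fg.
suff du : differentiable (g - f) a.
  have -> : g = (g - f) + f by apply/funext => x; rewrite !fctE subrK.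
  exact: differentiableD.
have eq0 : (g - f) \o shift a = cst ((g - f) a) + 0 +o_ (0 : V) id.
  apply/eqaddoP => e e0.
  have : \forall x \near (0 : V), f (x + a) = g (x + a).
    have := fg; rewrite (near_shift 0) subr0 /=.
    by apply: filterS => x /=.
  apply: filterS => x /= fgx.
  rewrite /= [X in `|X|](_ : _ = 0) ?normr0 ?mulr_ge0 ?(ltW e0) //.
  change ((g (x + a) - f (x + a)) - ((g a - f a) + 0) = 0).
  by rewrite fga fgx !subrr addr0 subrr.
have c0 : continuous (\0 : V -> W) by move=> x; exact: cvg_cst.
have d0 := @diff_unique _ _ _ (g - f) (\0 : {linear V -> W}) a c0 eq0.
apply/diff_locallyP; split; rewrite d0 //.
Qed.

End NearDifferentiable.

Section ClassC.
Context {R : realType} {m : nat}.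
Implicit Types (U V W : set 'rV[R]_m) (f g : 'rV[R]_m -> R).

Lemma class_C_pred k U f : class_C k.+1 U f -> class_C k U f.
Proof.
elim: k f => [|k IH] f [df Df]; first by move=> x /df /differentiable_continuous.
by split=> // v; apply: IH; apply: Df.
Qed.

Lemma class_C_sub k U V f : V `<=` U -> class_C k U f -> class_C k V f.
Proof.
move=> VU; elim: k f => [|k IH] f /=; first by move=> h x /VU /h.
by case=> df Df; split=> [x /VU /df //|v]; apply: IH; apply: Df.
Qed.

Lemma class_C_eq k U f g : open U -> (forall x, U x -> f x = g x) ->
  class_C k U f -> class_C k U g.
Proof.
move=> oU; elim: k f g => [|k IH] f g fg /=.
  move=> h x Ux; have fgx : \forall y \near x, f y = g y.
    by apply: filterS (open_nbhs_nbhs (conj oU Ux)) => y /fg.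
  rewrite /prop_for /continuous_at -(fg x Ux).
  have := h x Ux; rewrite /prop_for /continuous_at => fx.
  exact: cvg_trans (near_eq_cvg fgx) fx.
have near_fg x : U x -> \forall y \near x, f y = g y.
  by move=> Ux; apply: filterS (open_nbhs_nbhs (conj oU Ux)) => y /fg.
case=> df Df; split=> [x Ux|v].
  exact: near_eq_differentiable (near_fg x Ux) (df x Ux).
by apply: (IH _ _ _ (Df v)) => x Ux; apply: near_eq_derive; apply: near_fg.
Qed.

(** The hypothesis passes to each ['D_v f] with the same [W], since [W] carries all
    derivatives up to order [k]. *)
Lemma class_C_local k U f :
  (forall p, U p -> exists2 W, W p & class_C k W f) -> class_C k U f.
Proof.
elim: k f => [|k IH] f /= h.
  by move=> x Ux; have [W Wx] := h x Ux; apply.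
split=> [x Ux|v]; first by have [W Wx [dW _]] := h x Ux; apply: dW.
by apply: IH => p Up; have [W Wp [_ /(_ v)]] := h p Up; exists W.
Qed.

Lemma class_C_cst k U (c : R) : class_C k U (fun=> c).
Proof.
elim: k c => [|k IH] c /=; first by move=> x _; apply: cst_continuous.
split=> [x _|v]; first exact: differentiable_cst.
rewrite (_ : 'D_v (fun=> c) = fun=> 0) //.
by apply/funext => x; rewrite (derive_cst c).
Qed.

Lemma deriveDE f g x v : differentiable f x -> differentiable g x ->
  'D_v (fun y => f y + g y) x = 'D_v f x + 'D_v g x.
Proof. by move=> df dg; apply: (@deriveD _ _ _ f g); apply: diff_derivable. Qed.

Lemma deriveME f g x v : differentiable f x -> differentiable g x ->
  'D_v (fun y => f y * g y) x = f x * 'D_v g x + 'D_v f x * g x.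
Proof.
move=> df dg; have := @deriveM _ _ f g x v (diff_derivable df) (diff_derivable dg).
by move=> ->; congr (_ + _); rewrite [LHS]mulrC.
Qed.

Lemma class_CD k U f g : open U -> class_C k U f -> class_C k U g ->
  class_C k U (fun x => f x + g x).
Proof.
move=> oU; elim: k f g => [|k IH] f g /=.
  by move=> hf hg x Ux; exact: (continuousD (hf x Ux) (hg x Ux)).
case=> df Df [dg Dg]; split=> [x Ux|v].
  by apply: (@differentiableD _ _ _ f g); [apply: df|apply: dg].
apply: class_C_eq oU _ (IH _ _ (Df v) (Dg v)) => x Ux.
by rewrite deriveDE //; [apply: df|apply: dg].
Qed.

Lemma class_CM k U f g : open U -> class_C k U f -> class_C k U g ->
  class_C k U (fun x => f x * g x).
Proof.
move=> oU; elim: k f g => [|k IH] f g.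
  by move=> hf hg x Ux; exact: (continuousM (hf x Ux) (hg x Ux)).
move=> cf cg; have [df Df] := cf; have [dg Dg] := cg; split=> [x Ux|v].
  by apply: (@differentiableM _ _ f g); [apply: df|apply: dg].
apply: class_C_eq oU _ (class_CD oU (IH _ _ (class_C_pred cf) (Dg v))
  (IH _ _ (Df v) (class_C_pred cg))) => x Ux.
by rewrite deriveME //; [apply: df|apply: dg].
Qed.

Lemma class_C_sum k U (I : eqType) (s : seq I) (F : I -> 'rV[R]_m -> R) :
  open U -> (forall i, i \in s -> class_C k U (F i)) ->
  class_C k U (fun x => \sum_(i <- s) F i x).
Proof.
move=> oU; elim: s => [|i s IH] h.
  rewrite (_ : (fun x => _) = fun=> 0); first exact: class_C_cst.
  by apply/funext => x; rewrite big_nil.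
rewrite (_ : (fun x => _) = fun x => F i x + \sum_(j <- s) F j x).
  apply: class_CD => //; first by apply: h; rewrite mem_head.
  by apply: IH => j js; apply: h; rewrite inE js orbT.
by apply/funext => x; rewrite big_cons.
Qed.

Lemma class_C_coord k U i : class_C k U (fun x => x 0 i).
Proof.
case: k => [|k]; first by move=> x _; apply: coord_continuous.
split=> [x _|v]; first exact: differentiable_coord.
rewrite (_ : 'D_v (fun x : 'rV[R]_m => x 0 i) = fun=> v 0 i); first exact: class_C_cst.
apply/funext => x.
have -> : v 0 i = ('D_v id x) 0 i by rewrite derive_id.
by rewrite (@derive_mx _ _ _ _ id) ?mxE //; apply: derivable_id.
Qed.

Lemma class_CV k U f : open U -> (forall x, U x -> f x != 0) ->
  class_C k U f -> class_C k U (fun x => (f x)^-1).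
Proof.
move=> oU f0; elim: k => [|k IH] cf.
  by move=> x Ux; exact: (continuousV (f0 x Ux) (cf x Ux)).
have [df Df] := cf; have cV := IH (class_C_pred cf); split=> [x Ux|v].
  by apply: (@differentiableV _ _ f); [apply: df|apply: f0].
apply: class_C_eq oU _
  (class_CM oU (class_C_cst k U (-1)) (class_CM oU (Df v) (class_CM oU cV cV))).
move=> x Ux; have := @deriveV _ _ f x v (f0 x Ux) (diff_derivable (df x Ux)).
move=> ->; change (-1 * ('D_v f x * ((f x)^-1 * (f x)^-1)) =
  - (f x) ^- 2 * 'D_v f x).
by rewrite expr2 invfM; ring.
Qed.

End ClassC.

Section Comp.
Context {R : realType} {p m : nat}.
Implicit Types (F : 'rV[R]_p -> 'rV[R]_m) (f : 'rV[R]_m -> R).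

Lemma differentiable_rV F x :
  (forall i, differentiable (fun y => F y 0 i) x) -> differentiable F x.
Proof.
move=> dF; rewrite (_ : F = \sum_(i < m) (fun y => F y 0 i *: delta_mx 0 i)).
  by apply: differentiable_sum => i; apply: differentiableZl.
apply/funext => y; rewrite [LHS]row_sum_delta.
elim/big_rec2: _ => // i u v _ ->.
by [].
Qed.

Lemma derive_lin f x (a : R) (u v : 'rV[R]_m) : differentiable f x ->
  'D_(a *: u + v) f x = a * 'D_u f x + 'D_v f x.
Proof. by move=> df; rewrite !deriveE // linearP. Qed.

Lemma derive_rV_sum f x (v : 'rV[R]_m) : differentiable f x ->
  'D_v f x = \sum_i v 0 i * 'D_(delta_mx 0 i) f x.
Proof.
move=> df; rewrite deriveE // {1}(row_sum_delta v) linear_sum /=.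
by apply: eq_bigr => i _; rewrite linearZ deriveE.
Qed.

Lemma derive_chain f F x v :
  (forall i, differentiable (fun y => F y 0 i) x) -> differentiable f (F x) ->
  'D_v (fun y => f (F y)) x =
  'D_(\row_i 'D_v (fun y => F y 0 i) x) f (F x).
Proof.
move=> dF df; have dF' := differentiable_rV dF.
rewrite deriveE; last exact: differentiable_comp.
rewrite (@diff_comp _ _ _ _ F f) //= -deriveE // -deriveE //; congr ('D_ _ f _).
rewrite derive_mx; last exact: diff_derivable.
by apply/rowP => i; rewrite !mxE.
Qed.

(** By the chain rule, the derivatives of the composite are sums of products of
    derivatives of [F] with composites of derivatives of [f], to which the
    induction hypothesis applies. *)
Lemma class_C_comp k (U : set 'rV[R]_p) (V : set 'rV[R]_m) f F :
  open U -> (forall x, U x -> V (F x)) ->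
  (forall i, class_C k U (fun x => F x 0 i)) -> class_C k V f ->
  class_C k U (fun x => f (F x)).
Proof.
move=> oU UV; elim: k f => [|k IH] f cF.
  move=> cf x Ux; apply: (@continuous_comp _ _ _ F f); last exact: cf (UV _ Ux).
  rewrite (_ : F = \sum_(i < m) (fun y => F y 0 i *: delta_mx 0 i)); last first.
    apply/funext => y; rewrite [LHS]row_sum_delta.
    by elim/big_rec2: _ => // i u v _ ->.
  elim/big_rec: _ => [|i G _ cG]; first exact: cst_continuous.
  apply: continuousD; last exact: cG.
  apply: (@continuous_comp _ _ _ (fun y => F y 0 i) (fun c => c *: delta_mx 0 i)).
    exact: cF i x Ux.
  exact: scalel_continuous.
have cF' i : class_C k U (fun x => F x 0 i) by apply/class_C_pred/cF.
move=> [df Df]; split=> [x Ux|v].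
  apply: (@differentiable_comp _ _ _ _ F f); last exact: df (UV _ Ux).
  by apply: differentiable_rV => i; have [dF _] := cF i; apply: dF.
apply: (class_C_eq oU _ (@class_C_sum _ _ k U _ (index_enum 'I_m)
  (fun i x => 'D_v (fun y => F y 0 i) x * 'D_(delta_mx 0 i) f (F x)) oU _)).
  move=> x Ux; have dFx i : differentiable (fun y => F y 0 i) x.
    by have [dF _] := cF i; apply: dF.
  rewrite derive_chain //; last exact: df (UV _ Ux).
  rewrite [RHS]derive_rV_sum; last exact: df (UV _ Ux).
  by apply: eq_bigr => i _; rewrite mxE.
move=> i _; have [_ dFi] := cF i.
exact: (class_CM oU (dFi v) (IH _ cF' (Df (delta_mx 0 i)))).
Qed.

End Comp.

Section Flat.
Context {R : realType}.

(** The functions t^-k exp(-1/t), extended by 0 to the left of 0: a family of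
    flat functions closed under differentiation up to linear combinations, so
    that one induction shows them all smooth. *)
Definition flat (k : nat) (t : R) : R :=
  if 0 < t then (t^-1) ^+ k * expR (- t^-1) else 0.

(** A quadratic bound is what differentiability at 0 takes; it is the term of
    degree k+2 of the exponential series at 1/t. *)
Lemma flat_bound k (t : R) : `|flat k t| <= (k.+2)`!%:R * t ^+ 2.
Proof.
rewrite /flat; case: ifPn => [t0|_]; last first.
  by rewrite normr0 mulr_ge0 // sqr_ge0.
have s0 : 0 < t^-1 by rewrite invr_gt0.
rewrite ger0_norm; last by rewrite mulr_ge0 ?exprn_ge0 ?expR_ge0 // ltW.
have := expR_ge1Dxn k.+1 (ltW s0); set s := t^-1 in s0 *.
have -> : t = s^-1 by rewrite /s invrK.
clearbody s.
move=> hs; rewrite expRN ler_pdivrMr ?expR_gt0 //.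
have {}hs : s ^+ k.+2 <= (k.+2)`!%:R * expR s.
  rewrite mulrC -ler_pdivrMr ?ltr0n ?fact_gt0 //.
  by apply: le_trans hs; rewrite lerDr ler01.
rewrite mulrAC exprVn ler_pdivlMr ?exprn_gt0 //.
by rewrite -exprD addn2.
Qed.

Lemma is_derive_flat k (t : R) :
  is_derive t 1 (flat k) (flat k.+2 t - k%:R * flat k.+1 t).
Proof.
have [t0|t0|t0] := ltgtP t 0.
- have -> : flat k.+2 t - k%:R * flat k.+1 t = 0.
    by rewrite /flat ltNge (ltW t0) /= mulr0 subr0.
  apply: near_eq_is_derive (is_derive_cst 0 t 1).
  near=> s; rewrite /flat ltNge (_ : s <= 0) //.
  by apply: ltW; near: s; exact: lt_nbhsl.
- have -> : flat k.+2 t - k%:R * flat k.+1 t =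
      (t^-1 ^+ k.+2 - k%:R * t^-1 ^+ k.+1) * expR (- t^-1).
    by rewrite /flat t0; ring.
  have tn : t != 0 by rewrite gt_eqF.
  apply: (@near_eq_is_derive _ _ _ (fun s : R => (s^-1) ^+ k * expR (- s^-1))).
    near=> s; rewrite /flat ifT //; near: s; exact: lt_nbhsr.
  have dV : is_derive t 1 (fun s : R => s^-1) (- t^-1 ^+ 2).
    have d1 := diff_derivable (differentiable_Rinv tn).
    apply: DeriveDef; first exact: d1.
    rewrite deriveE; last exact: differentiable_Rinv.
    by rewrite diff_Rinv // exprVn; apply: mulr1.
  have dE := @is_derive1_comp R expR (- (fun s : R => s^-1)) t _ _
    (is_derive_expR (- t^-1)) (is_deriveN dV).
  have dX := is_deriveX k dV.
  have -> : (fun s : R => s^-1 ^+ k * expR (- s^-1)) =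
      (fun s : R => s^-1) ^+ k * (expR \o - (fun s : R => s^-1)).
    by apply/funext => s; rewrite exprfctE.
  apply: (is_derive_eq (is_deriveM dX dE)); rewrite exprfctE.
  have aux (E v : R) : v ^+ k * (E * - - v ^+ 2) + E * (k%:R * v ^+ k.-1 * - v ^+ 2)
      = (v ^+ k.+2 - k%:R * v ^+ k.+1) * E.
    by case: k {dX} => [|k] /=; [ring | rewrite -natr1 !exprS; ring].
  exact: aux.
- rewrite t0; have -> : flat k.+2 0 - k%:R * flat k.+1 0 = 0 :> R.
    by rewrite /flat ltxx mulr0 subr0.
  pose C : R := (k.+2)`!%:R.
  have C0 : 0 < C by rewrite ltr0n fact_gt0.
  have c0 : h^-1 *: (flat k (h *: 1 + 0) - flat k 0) @[h --> 0^'] --> (0 : R).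
    apply/cvgrPdist_le => e e0; near=> h.
    have h0 : h != 0 by near: h; exact: nbhs_dnbhs_neq.
    rewrite {2}/flat ltxx subr0 addr0 sub0r normrN normrZ [h *: 1]mulr1.
    rewrite normfV ler_pdivrMl ?normr_gt0 //.
    apply: le_trans (flat_bound k h) _.
    rewrite -real_normK ?num_real // -/C expr2 mulrCA ler_pM2l ?normr_gt0 //.
    rewrite -ler_pdivlMl // mulrC.
    near: h; apply: dnbhs0_le; exact: divr_gt0.
  by apply: DeriveDef; [apply/cvg_ex; exists 0 | apply: cvg_lim].
Unshelve. all: by end_near. Qed.

End Flat.

(** * Bump functions *)

Section Bump.
Context {R : realType} {m : nat}.
Implicit Types (U V : set 'rV[R]_m) (f : 'rV[R]_m -> R).

Lemma class_C_flat k j U f : open U -> class_C k U f ->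
  class_C k U (fun x => flat j (f x)).
Proof.
move=> oU; elim: k j => [|k IH] j cf.
  move=> x Ux; apply: (@continuous_comp _ _ _ f (flat j)); first exact: cf.
  apply: differentiable_continuous; apply/derivable1_diffP.
  by have [] := is_derive_flat j (f x).
have dflat (t : R) : differentiable (flat j) t.
  by apply/derivable1_diffP; have [] := is_derive_flat j t.
have [df Df] := cf; have cf' := class_C_pred cf; split=> [x Ux|v].
  by apply: (@differentiable_comp _ _ _ _ f (flat j)); [apply: df|apply: dflat].
apply: (class_C_eq oU _ (class_CM oU (Df v) (class_CD oU (IH j.+2 cf')
  (class_CM oU (class_C_cst k U (- j%:R)) (IH j.+1 cf'))))) => x Ux.
rewrite [RHS]deriveE; last first.
  by apply: (@differentiable_comp _ _ _ _ f (flat j)); [apply: df|apply: dflat].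
rewrite (@diff_comp _ _ _ _ f (flat j)) //=; last exact: df.
rewrite -(deriveE v (df x Ux)) -[X in 'd _ _ X]mulr1 [RHS]linearZ /=.
rewrite -deriveE //; have [_ ->] := is_derive_flat j (f x).
by rewrite mulNr.
Qed.

Lemma class_C_prod k U (I : eqType) (s : seq I) (F : I -> 'rV[R]_m -> R) :
  open U -> (forall i, i \in s -> class_C k U (F i)) ->
  class_C k U (fun x => \prod_(i <- s) F i x).
Proof.
move=> oU; elim: s => [|i s IH] h.
  rewrite (_ : (fun x => _) = fun=> 1); first exact: class_C_cst.
  by apply/funext => x; rewrite big_nil.
rewrite (_ : (fun x => _) = fun x => F i x * \prod_(j <- s) F j x).
  apply: class_CM => //; first by apply: h; rewrite mem_head.
  by apply: IH => j js; apply: h; rewrite inE js orbT.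
by apply/funext => x; rewrite big_cons.
Qed.

(** A product over the coordinates of [flat 0] of r^2 - (p_i - q_i)^2 is
    supported in a closed cube, normalized by its value at [q]. *)
Lemma exists_bump V (q : 'rV[R]_m) : open V -> V q ->
  exists (b : 'rV[R]_m -> R) (C : set 'rV[R]_m),
    [/\ smooth_on setT b, compact C, C `<=` V,
        b q = 1 & forall p, ~ C p -> b p = 0].
Proof.
move=> oV Vq; have : nbhs q V by apply: open_nbhs_nbhs.
rewrite -nbhs_ballE => -[e /= e0 qeV]; pose r := e / 2.
have r0 : 0 < r by rewrite divr_gt0.
pose c : R := flat 0 (r ^+ 2); have c0 : c != 0.
  by rewrite /c /flat exprn_gt0 // expr0 mul1r gt_eqF ?expR_gt0.
pose b (p : 'rV[R]_m) := \prod_(i < m)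
  (c^-1 * flat 0 (r ^+ 2 + - 1 * ((p 0 i + - q 0 i) * (p 0 i + - q 0 i)))).
pose C : set 'rV[R]_m := [set p | forall i, `[q 0 i - r, q 0 i + r]%classic (p 0 i)].
exists b, C; split.
- move=> k; apply: class_C_prod; first exact: openT.
  move=> i _; have oT := @openT 'rV[R]_m; apply: (class_CM oT (class_C_cst _ _ _)).
  apply: class_C_flat => //.
  have h := class_CD oT (class_C_coord k setT i) (class_C_cst k setT (- q 0 i)).
  exact: (class_CD oT (class_C_cst _ _ _)
    (class_CM oT (class_C_cst _ _ _) (class_CM oT h h))).
- apply: (@rV_compact _ _ (fun i => `[q 0 i - r, q 0 i + r]%classic)) => i.
  exact: segment_compact.
- move=> p Cp; apply: qeV; split=> // i j; rewrite ord1.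
  have := Cp j; rewrite /= in_itv /= => /andP[h1 h2].
  rewrite /ball /= ltr_norml; apply/andP; split; rewrite /r in r0 h1 h2; lra.
- rewrite /b big1 // => i _; rewrite subrr mulr0 mulr0 addr0 mulVf //.
- move=> p nCp.
  have [i ni] : exists i, ~ `[q 0 i - r, q 0 i + r]%classic (p 0 i) by apply/existsNP.
  rewrite /b (bigD1 i) //= /flat ifF ?mulr0 ?mul0r //.
  apply/negbTE; rewrite -leNgt mulN1r subr_le0 -expr2.
  case: (lerP (r ^+ 2) ((p 0 i - q 0 i) ^+ 2)) => // hlt; exfalso; apply: ni.
  move: hlt; rewrite -(real_normK (num_real (p 0 i - q 0 i))).
  rewrite ltr_pXn2r ?nnegrE ?normr_ge0 ?(ltW r0) //.
  rewrite ltr_norml => /andP[h1 h2]; rewrite /= in_itv /=.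
  by apply/andP; split; lra.
Qed.

End Bump.

(** * Smooth functions on a manifold *)

Section SmoothFunctions.
Context {R : realType} {m : nat} {M : manifold R m}.
Implicit Types (f : M -> R) (x y z : M).

Definition codom x : set 'rV[R]_m := chart M x @` dom M x.

Lemma mem_codom x y : dom M x y -> codom x (chart M x y).
Proof. by move=> xy; exists y. Qed.

Lemma chart_invK x p : codom x p ->
  dom M x (chart_inv M x p) /\ chart M x (chart_inv M x p) = p.
Proof. by move=> [y xy <-]; rewrite chartK. Qed.

Lemma nbhs_dom x y : dom M x y -> nbhs y (dom M x).
Proof. by move=> xy; apply: open_nbhs_nbhs; split=> //; apply: open_dom. Qed.

(** Inverse charts are only known to be continuous at the points of their
    codomains, so preimages of open sets are intersected with the codomain. *)
Lemma open_chart_preimage x (A : set M) : open A ->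
  open (codom x `&` chart_inv M x @^-1` A).
Proof.
move=> oA; rewrite openE => p [cp Ap]; apply: filterI.
  by apply: open_nbhs_nbhs; split=> //; apply: open_codom.
by apply: (chart_inv_continuous cp); apply: open_nbhs_nbhs.
Qed.

Lemma open_overlap x y : open (chart M x @` (dom M x `&` dom M y)).
Proof.
rewrite (_ : _ @` _ = codom x `&` chart_inv M x @^-1` dom M y).
  by apply: open_chart_preimage; apply: open_dom.
apply/seteqP; split=> [p [z [xz yz] <-]|p [cp yp]].
  by split; [apply: mem_codom|rewrite /= chartK].
by have [xp <-] := chart_invK cp; exists (chart_inv M x p).
Qed.

Lemma near_chart_inv x y (A : set M) : dom M x y -> nbhs y A ->
  \forall p \near chart M x y, codom x p /\ A (chart_inv M x p).
Proof.
move=> xy nA; apply: filterI.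
  by apply: open_nbhs_nbhs; split; [apply: open_codom|apply: mem_codom].
by apply: (chart_inv_continuous (mem_codom xy)); rewrite chartK.
Qed.

Lemma smooth_on_differentiable (U : set 'rV[R]_m) (f : 'rV[R]_m -> R) p :
  smooth_on U f -> U p -> differentiable f p.
Proof. by move=> sf Up; have [df _] := sf 1%N; apply: df. Qed.

Lemma smooth_differentiable f x y : smooth f -> dom M x y ->
  differentiable (f \o chart_inv M x) (chart M x y).
Proof.
by move=> sf xy; apply: smooth_on_differentiable (sf x) _; apply: mem_codom.
Qed.

Lemma transition_differentiable x y z i : dom M x z -> dom M y z ->
  differentiable (fun p => chart M y (chart_inv M x p) 0 i) (chart M x z).
Proof.
move=> xz yz; apply: smooth_on_differentiable (transition_smooth x y i) _.
by exists z.
Qed.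

Lemma smooth_cst (c : R) : smooth (fun _ : M => c).
Proof. by move=> x k; apply: class_C_cst. Qed.

Lemma smoothD f g : smooth f -> smooth g -> smooth (fun x => f x + g x).
Proof.
move=> sf sg x k; apply: (class_CD _ (sf x k) (sg x k)); exact: open_codom.
Qed.

Lemma smoothM f g : smooth f -> smooth g -> smooth (fun x => f x * g x).
Proof.
move=> sf sg x k; apply: (class_CM _ (sf x k) (sg x k)); exact: open_codom.
Qed.

Lemma smoothB f g : smooth f -> smooth g -> smooth (fun x => f x - g x).
Proof.
move=> sf sg; rewrite (_ : (fun x => _) = fun x => f x + (-1) * g x).
  exact: smoothD sf (smoothM (smooth_cst _) sg).
by apply/funext => x; rewrite mulN1r.
Qed.

Lemma smooth_continuous f x : smooth f -> {for x, continuous f}.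
Proof.
move=> sf; have c1 := sf x 0%N _ (mem_codom (mem_dom x)).
have c2 := chart_continuous (mem_dom x).
have := continuous_comp c2 c1; rewrite /prop_for /continuous_at /= chartK; last exact: mem_dom.
move=> c; apply: cvg_trans c; apply: near_eq_cvg.
by apply: filterS (nbhs_dom (mem_dom x)) => y xy /=; rewrite chartK.
Qed.

(** Only the value of the denominator at the point itself has to be nonzero:
    continuity takes care of a neighbourhood. *)
Lemma smooth_local_quotient f :
  (forall x, exists u v : M -> R, [/\ smooth u, smooth v, v x != 0 &
     \forall y \near x, f y * v y = u y]) -> smooth f.
Proof.
move=> loc x k; apply: class_C_local => p [z xz zp].
have [u [v [su sv vz fuv]]] := loc z.
have nv : \forall y \near z, v y != 0.
  have cv : v @ z --> v z := smooth_continuous sv.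
  have : nbhs (v z) [set t | t != 0].
    by apply: open_nbhs_nbhs; split=> //; apply: open_neq.
  by move=> /cv.
have : nbhs z (fun y => f y * v y = u y /\ v y != 0) by apply: filterI.
rewrite nbhsE => -[A [oA Az] hA].
exists (codom x `&` chart_inv M x @^-1` A).
  by rewrite -zp; split; [apply: mem_codom|rewrite /= chartK].
have oW := @open_chart_preimage x A oA.
apply: (@class_C_eq _ _ k _ (fun p => (u \o chart_inv M x) p * ((v \o chart_inv M x) p)^-1)) => //.
  by move=> q [_ /hA [/= <- vq]]; rewrite mulfK.
have sub : (codom x `&` chart_inv M x @^-1` A) `<=` codom x by move=> q [].
apply: class_CM => //; first exact: class_C_sub (su x k).
apply: class_CV => //; last exact: class_C_sub (sv x k).
by move=> q [_ /hA [_]].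
Qed.

Definition chart_ext x (q : 'rV[R]_m -> R) y : R :=
  if `[< dom M x y >] then q (chart M x y) else 0.

Lemma chart_extE x q y : dom M x y -> chart_ext x q y = q (chart M x y).
Proof. by move=> xy; rewrite /chart_ext ifT //; apply/asboolP. Qed.

(** At a point outside the chart domain the extension vanishes nearby because
    the support, being the image of a compact set in a Hausdorff space, is
    closed. *)
Lemma smooth_chart_ext x (C : set 'rV[R]_m) q : compact C -> C `<=` codom x ->
  (forall p, ~ C p -> q p = 0) -> smooth_on (codom x) q -> smooth (chart_ext x q).
Proof.
move=> cC Cx q0 sq y k; apply: class_C_local => p [z yz zp].
have [xz|nxz] := pselect (dom M x z).
  exists (chart M y @` (dom M y `&` dom M x)); first by exists z.
  have oW := @open_overlap y x.
  apply: (class_C_eq oW _ (@class_C_comp _ _ _ k _ (codom x) q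
    (fun p => chart M x (chart_inv M y p)) oW _ (fun i => transition_smooth y x i k) (sq k))).
    by move=> _ [w [yw xw] <-] /=; rewrite chartK // chart_extE.
  by move=> _ [w [yw xw] <-] /=; rewrite chartK //; apply: mem_codom.
pose K := chart_inv M x @` C.
have cK : closed K.
  apply: compact_closed; first exact: manifold_hausdorff.
  apply: continuous_compact => //; apply: continuous_in_subspaceT => w.
  by rewrite inE => /Cx; apply: chart_inv_continuous.
exists (codom y `&` chart_inv M y @^-1` (~` K)).
  rewrite -zp; split; first exact: mem_codom.
  by rewrite /= chartK // => -[w /Cx cw wz]; apply: nxz; rewrite -wz; have [] := chart_invK cw.
have oW : open (codom y `&` chart_inv M y @^-1` (~` K)).
  by apply: open_chart_preimage; apply: closed_openC.
apply: (class_C_eq oW _ (class_C_cst k _ 0)) => w [_ /= nKw].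
rewrite /chart_ext; case: ifPn => // /asboolP xw; rewrite q0 // => Cw.
by apply: nKw; exists (chart M x (chart_inv M y w)) => //; rewrite chartK.
Qed.

End SmoothFunctions.

(** * Vector fields *)

Section VectorFields.
Context {R : realType} {m : nat} {M : manifold R m}.
Implicit Types (f g : M -> R) (x y z : M) (X Y Z : vfield M).

Lemma tderive_lin x (a : R) u v f : smooth f ->
  tderive x (a *: u + v) f = a * tderive x u f + tderive x v f.
Proof.
by move=> sf; apply: derive_lin; apply: smooth_differentiable => //; apply: mem_dom.
Qed.

Lemma tderiveD x u f g : smooth f -> smooth g ->
  tderive x u (fun y => f y + g y) = tderive x u f + tderive x u g.
Proof.
by move=> sf sg; apply: (@deriveDE _ _ (f \o chart_inv M x) (g \o chart_inv M x));
  apply: smooth_differentiable => //; apply: mem_dom.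
Qed.

Lemma smooth_vfield_comb f X Y : smooth f -> smooth_vfield X -> smooth_vfield Y ->
  smooth_vfield (fun y => f y *: X y + Y y).
Proof.
move=> sf sX sY g sg.
rewrite (_ : fderive _ _ = fun y => f y * fderive X g y + fderive Y g y).
  exact: smoothD (smoothM sf (sX _ sg)) (sY _ sg).
by apply/funext => y; apply: tderive_lin.
Qed.

(** The coordinate field d/dx^i of the chart at [x], cut off to 0 outside its
    domain; its value at [y] is expressed in the chart at [y]. *)
Definition coord_vfield x (i : 'I_m) : vfield M := fun y =>
  if `[< dom M x y >] then
    \row_j 'D_(delta_mx 0 i) (fun p => chart M y (chart_inv M x p) 0 j) (chart M x y)
  else 0.

(** The i-th component of the tangent vector [u] at [y] in the chart at [x] *)
Definition component x i y (u : 'rV[R]_m) : R :=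
  'D_u (fun p => chart M x (chart_inv M y p) 0 i) (chart M y y).

Lemma component_self x i u : component x i x u = u 0 i.
Proof.
rewrite /component (@near_eq_derive _ _ _ _ (fun p : 'rV[R]_m => p 0 i)).
  have -> : u 0 i = ('D_u id (chart M x x)) 0 i by rewrite derive_id.
  by rewrite (@derive_mx _ _ _ _ id) ?mxE //; apply: derivable_id.
apply: filterS (near_chart_inv (mem_dom x) (nbhs_dom (mem_dom x))) => p [cp _].
by have [_ ->] := chart_invK cp.
Qed.

Lemma coord_vfield_self x i : coord_vfield x i x = delta_mx 0 i.
Proof.
rewrite /coord_vfield ifT; last by apply/asboolP/mem_dom.
by apply/rowP => j; rewrite mxE -[RHS](component_self x j).
Qed.

(** Both sides are derivatives of [f] along the same coordinate curve; the left
    one passes through the chart at [y], in which the field is expressed. *)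
Lemma coord_vfieldE x i y f : smooth f -> dom M x y ->
  tderive y (coord_vfield x i y) f =
  'D_(delta_mx 0 i) (f \o chart_inv M x) (chart M x y).
Proof.
move=> sf xy; rewrite /coord_vfield ifT; last exact/asboolP.
have := @derive_chain _ _ _ (f \o chart_inv M y)
  (fun p => chart M y (chart_inv M x p)) (chart M x y) (delta_mx 0 i).
rewrite /tderive /= chartK //= => <-.
- apply: near_eq_derive.
  apply: filterS (near_chart_inv xy (nbhs_dom (mem_dom y))) => p [_ yp] /=.
  by rewrite chartK.
- by move=> j; apply: transition_differentiable => //; apply: mem_dom.
- by apply: smooth_differentiable => //; apply: mem_dom.
Qed.

(** The Jacobians of the two transition maps between the charts at [x] and [y]
    are mutually inverse. *)
Lemma component_sum x y u : dom M x y ->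
  \sum_i component x i y u *: coord_vfield x i y = u.
Proof.
move=> xy; apply/rowP => j.
have := @derive_chain _ _ _ (fun p => chart M y (chart_inv M x p) 0 j)
  (fun p => chart M x (chart_inv M y p)) (chart M y y) u.
rewrite /= chartK; last exact: mem_dom.
have d1 i : differentiable (fun p => chart M x (chart_inv M y p) 0 i) (chart M y y).
  by apply: transition_differentiable => //; apply: mem_dom.
have d2 : differentiable (fun p => chart M y (chart_inv M x p) 0 j) (chart M x y).
  by apply: transition_differentiable => //; apply: mem_dom.
move=> /(_ d1 d2); rewrite [X in _ = X -> _]derive_rV_sum // => h.
transitivity (component y j y u); last exact: component_self.
rewrite summxE /component.
rewrite (@near_eq_derive _ _ _ _ (fun p =>
    chart M y (chart_inv M x (chart M x (chart_inv M y p))) 0 j)).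
  rewrite h; apply: eq_bigr => i _; rewrite !mxE /coord_vfield ifT ?mxE //.
  exact/asboolP.
apply: filterS (near_chart_inv (mem_dom y) (nbhs_dom xy)) => p [_ xp].
by rewrite chartK.
Qed.

End VectorFields.

(** * Local frames and tensoriality *)

Section Frames.
Context {R : realType} {m : nat} {M : manifold R m}.
Implicit Types (f g : M -> R) (x y z : M) (X Y Z : vfield M).

Lemma class_C_derive k U (q : 'rV[R]_m -> R) v :
  smooth_on U q -> class_C k U ('D_v q).
Proof. by move=> sq; have [_ h] := sq k.+1; apply: h. Qed.

(** The last clause is what makes everything expressed in the chart at [x]
    globally smooth after multiplication by the cut-off function. *)
Lemma exists_cutoff x : exists phi : M -> R,
  [/\ smooth phi, phi x = 1, forall y, ~ dom M x y -> phi y = 0 &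
      forall q, smooth_on (codom x) q ->
        smooth (fun y => phi y * chart_ext x q y)].
Proof.
have oV : open (codom x) by apply: open_codom.
have [b [C [sb cC CV bx b0]]] := exists_bump oV (mem_codom (mem_dom x)).
have sb' : smooth_on (codom x) b by move=> k; apply: class_C_sub (sb k).
exists (chart_ext x b); split.
- exact: smooth_chart_ext CV b0 sb'.
- by rewrite chart_extE //; apply: mem_dom.
- by move=> y nxy; rewrite /chart_ext ifN //; apply/asboolP.
move=> q sq; rewrite (_ : (fun y => _) = chart_ext x (fun p => b p * q p)).
  apply: (smooth_chart_ext cC CV).
    by move=> p /b0 ->; rewrite mul0r.
  by move=> k; apply: class_CM.
by apply/funext => y; rewrite /chart_ext; case: ifPn; rewrite ?mul0r.
Qed.

Lemma tderive_cutoff_coord x phi i y u : smooth phi -> dom M x y ->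
  tderive y u (fun z => phi z * chart_ext x (fun p => p 0 i) z) =
  phi y * component x i y u + tderive y u phi * chart M x y 0 i.
Proof.
move=> sphi xy; rewrite /tderive.
rewrite (@near_eq_derive _ _ _ _ (fun p =>
  (phi \o chart_inv M y) p * chart M x (chart_inv M y p) 0 i)).
  rewrite deriveME.
  - by rewrite /= chartK //; apply: mem_dom.
  - by apply: smooth_differentiable => //; apply: mem_dom.
  - by apply: transition_differentiable => //; apply: mem_dom.
apply: filterS (near_chart_inv (mem_dom y) (nbhs_dom xy)) => p [_ xp] /=.
by rewrite chart_extE.
Qed.

(** Vectors are separated by the cut-off coordinates: at [x] their derivative is
    the component of the vector, up to a multiple of the derivative of the
    cut-off function, which is the same for both vectors. *)
Lemma tderive_inj x u v :
  (forall f, smooth f -> tderive x u f = tderive x v f) -> u = v.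
Proof.
have [phi [sphi phix _ cut]] := exists_cutoff x.
move=> uv; apply/rowP => i.
have := uv _ (cut (fun p => p 0 i) (fun k => class_C_coord k _ i)).
have xx := @mem_dom _ _ M x.
rewrite !tderive_cutoff_coord // phix !mul1r (uv phi) // !component_self.
exact: addIr.
Qed.

(** With x^i the coordinates of the chart and phi a cut-off function, take E_i =
    phi d/dx^i. The components X^i of a field are only defined on the chart
    domain, but phi^2 X^i = phi X(phi x^i) - X(phi) phi x^i is built from
    globally smooth functions; whence phi^3 X = sum_i (phi^2 X^i) E_i. *)
Lemma exists_local_frame x :
  exists (phi : M -> R) (E : 'I_m -> vfield M),
    [/\ smooth phi, phi x = 1, forall i, smooth_vfield (E i),
        forall i, E i x = delta_mx 0 i &
        forall X, smooth_vfield X -> exists c : 'I_m -> M -> R,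
          [/\ forall i, smooth (c i), forall i, c i x = X x 0 i &
              forall y, phi y *: X y = \sum_i c i y *: E i y]].
Proof.
have [phi [sphi phix phi0 cut]] := exists_cutoff x.
pose E i : vfield M := fun y => phi y *: coord_vfield x i y.
pose co i y := phi y * chart_ext x (fun p => p 0 i) y.
have sco i : smooth (co i) by apply: cut => k; apply: class_C_coord.
exists (fun y => phi y * phi y * phi y), E; split.
- exact: smoothM (smoothM sphi sphi) sphi.
- by rewrite phix !mulr1.
- move=> i f sf.
  rewrite (_ : fderive _ _ = fun y =>
      phi y * chart_ext x ('D_(delta_mx 0 i) (f \o chart_inv M x)) y).
    by apply: cut => k; apply: class_C_derive (sf x).
  apply/funext => y; rewrite /fderive /E -[_ *: _]addr0 tderive_lin //.
  rewrite [X in _ + X](_ : _ = 0) ?addr0; last exact: derive0.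
  have [xy|/phi0 ->] := pselect (dom M x y); last by rewrite !mul0r.
  by rewrite coord_vfieldE // chart_extE.
- by move=> i; rewrite /E phix scale1r coord_vfield_self.
move=> X sX; pose c i y := phi y * fderive X (co i) y - fderive X phi y * co i y.
have cE i y : dom M x y -> c i y = phi y * phi y * component x i y (X y).
  move=> xy; rewrite /c /fderive tderive_cutoff_coord // /co chart_extE //.
  by ring.
exists c; split.
- move=> i; apply: smoothB; apply: smoothM => //; apply: sX => //.
- move=> i; rewrite cE; last exact: mem_dom.
  by rewrite phix !mul1r component_self.
move=> y; have [xy|/phi0 phiy] := pselect (dom M x y).
  rewrite -{1}(component_sum (X y) xy) scaler_sumr; apply: eq_bigr => i _.
  by rewrite cE // /E !scalerA; congr (_ *: _); ring.
by rewrite phiy !mulr0 scale0r big1 // => i _; rewrite /E phiy scale0r scaler0.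
Qed.

Lemma smooth_vfield0 : smooth_vfield ((fun=> 0) : vfield M).
Proof.
move=> f sf; rewrite (_ : fderive _ _ = fun=> 0); first exact: smooth_cst.
by apply/funext => y; apply: derive0.
Qed.

Lemma smooth_vfieldZ f X : smooth f -> smooth_vfield X ->
  smooth_vfield (fun y => f y *: X y).
Proof.
move=> sf sX; have := smooth_vfield_comb sf sX smooth_vfield0.
by under [X in smooth_vfield X]eq_fun do rewrite addr0.
Qed.

Lemma smooth_vfieldD X Y : smooth_vfield X -> smooth_vfield Y ->
  smooth_vfield (fun y => X y + Y y).
Proof.
move=> sX sY; have := smooth_vfield_comb (smooth_cst 1) sX sY.
by under [X in smooth_vfield X]eq_fun do rewrite scale1r.
Qed.

Lemma smooth_vfieldB X Y : smooth_vfield X -> smooth_vfield Y ->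
  smooth_vfield (fun y => X y - Y y).
Proof.
move=> sX sY; have := smooth_vfield_comb (smooth_cst (-1)) sY sX.
by under [X in smooth_vfield X]eq_fun do rewrite scaleN1r addrC.
Qed.

Lemma smooth_vfield_sum (I : eqType) (s : seq I) (F : I -> vfield M) :
  (forall i, smooth_vfield (F i)) ->
  smooth_vfield (fun y => \sum_(i <- s) F i y).
Proof.
move=> sF; elim: s => [|i s IH].
  rewrite (_ : (fun y => _) = fun=> 0); first exact: smooth_vfield0.
  by apply/funext => y; rewrite big_nil.
rewrite (_ : (fun y => _) = fun y => F i y + \sum_(j <- s) F j y).
  exact: smooth_vfieldD.
by apply/funext => y; rewrite big_cons.
Qed.

(** The frame fields combined with constant coefficients are an extension. *)
Lemma extensionP x u : smooth_vfield (extension x u : vfield M) /\ extension x u x = u.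
Proof.
have [phi [E [_ _ sE Ex _]]] := exists_local_frame x.
rewrite /extension; case: xgetP => [X _ //|]; move=> none; exfalso.
apply: (none (fun y => \sum_i u 0 i *: E i y)); split.
  by apply: smooth_vfield_sum => i; apply: smooth_vfieldZ => //; apply: smooth_cst.
by rewrite [RHS]row_sum_delta; apply: eq_bigr => i _; rewrite Ex.
Qed.

(** Writing X = (1 - phi) X + sum_i c_i E_i with phi(x) = 1, linearity gives
    T(X) = sum_i c_i(x) T(E_i), and c_i(x) is the i-th component of X(x). *)
Lemma tensorial (V : lmodType R) (T : vfield M -> V) x :
  (forall f X Y, smooth f -> smooth_vfield X -> smooth_vfield Y ->
     T (fun y => f y *: X y + Y y) = f x *: T X + T Y) ->
  forall X Y, smooth_vfield X -> smooth_vfield Y -> X x = Y x -> T X = T Y.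
Proof.
move=> Tlin.
have [phi [E [sphi phix sE Ex frame]]] := exists_local_frame x.
have T0 : T (fun=> 0) = 0.
  have := Tlin (fun=> 1) (fun=> 0) (fun=> 0) (smooth_cst 1) smooth_vfield0 smooth_vfield0.
  by rewrite scaler0 addr0 scale1r => /eqP; rewrite -subr_eq subrr eq_sym => /eqP.
suff TE X : smooth_vfield X -> T X = \sum_i X x 0 i *: T (E i).
  by move=> X Y sX sY XY; rewrite !TE // XY.
move=> sX; have [c [sc cx cE]] := frame X sX.
transitivity (T (fun y => (1 - phi y) *: X y + phi y *: X y)).
  by congr T; apply/funext => y; rewrite -scalerDl subrK scale1r.
rewrite Tlin //; last 2 first.
- exact: smoothB (smooth_cst 1) sphi.
- exact: smooth_vfieldZ.
rewrite phix subrr scale0r add0r.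
rewrite (_ : (fun y => phi y *: X y) = fun y => \sum_i c i y *: E i y); last first.
  by apply/funext.
under [RHS]eq_bigr do rewrite -cx.
elim: (index_enum _) => [|i s IH].
  by rewrite big_nil -[RHS]T0; congr T; apply/funext => y; rewrite big_nil.
rewrite big_cons -IH -Tlin //; last first.
  by apply: smooth_vfield_sum => j; apply: smooth_vfieldZ.
by congr T; apply/funext => y; rewrite big_cons.
Qed.

End Frames.

(** * The curvature of the Levi-Civita connection *)

Section Connection.
Context {R : realType} {n : nat} {K : kahler R n}.
Local Notation TM := 'rV[R]_(2 * n).
Implicit Types (f : K -> R) (x y : K) (X Y Z : vfield K) (u v w : TM).
Let LC := @nabla_levi_civita R n K.

Lemma g_lin x (a : R) u v w : g x (a *: u + v) w = a * g x u w + g x v w.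
Proof. by rewrite /g /inner !mulmxDl -!scalemxAl !mxE. Qed.

Lemma gC x u v : g x u v = g x v u.
Proof. by apply: riem_sym; apply: gram_riemannian. Qed.

Lemma smooth_g X Y : smooth_vfield X -> smooth_vfield Y ->
  smooth (fun x => g x (X x) (Y x)).
Proof. by apply: riem_smooth; apply: gram_riemannian. Qed.

Lemma smooth_nabla X Y : smooth_vfield X -> smooth_vfield Y ->
  smooth_vfield (nabla X Y).
Proof. exact: nabla_smooth LC _ _. Qed.

Lemma nabla_comb_l f X Y Z : smooth f ->
  smooth_vfield X -> smooth_vfield Y -> smooth_vfield Z ->
  nabla (fun y => f y *: X y + Y y) Z = fun y => f y *: nabla X Z y + nabla Y Z y.
Proof. by move=> sf sX sY sZ; apply/funext => y; apply: (nabla_linear_l LC). Qed.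

Lemma nabla_comb_r f X Y Z : smooth f ->
  smooth_vfield X -> smooth_vfield Y -> smooth_vfield Z ->
  nabla X (fun y => f y *: Y y + Z y) =
  fun y => f y *: nabla X Y y + (fderive X f y *: Y y + nabla X Z y).
Proof.
move=> sf sX sY sZ; apply/funext => y.
rewrite (nabla_additive_r LC sX (smooth_vfieldZ sf sY) sZ).
by rewrite (nabla_leibniz LC) // [X in X + _]addrC addrA.
Qed.

Lemma nablaB_l X Y Z : smooth_vfield X -> smooth_vfield Y -> smooth_vfield Z ->
  nabla (fun y => X y - Y y) Z = fun y => nabla X Z y - nabla Y Z y.
Proof.
move=> sX sY sZ; have := nabla_comb_l (smooth_cst (-1)) sY sX sZ.
under [X in nabla X]eq_fun do rewrite scaleN1r addrC.
by move=> ->; apply/funext => y; rewrite scaleN1r addrC.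
Qed.

(** The connection being torsion free, its antisymmetrization is a bracket;
    brackets are unique since vectors are determined by their action on
    functions. *)
Lemma bracketE X Y : smooth_vfield X -> smooth_vfield Y ->
  bracket X Y = fun x => nabla X Y x - nabla Y X x.
Proof.
move=> sX sY; have tf := nabla_torsion_free LC sX sY.
rewrite /bracket; case: xgetP => [Z _ [sZ hZ]|]; last by move=> /(_ _ tf).
apply/funext => x; apply: tderive_inj => f sf.
exact: (etrans (hZ f sf x) (esym (tf.2 f sf x))).
Qed.

Lemma smooth_bracket X Y : smooth_vfield X -> smooth_vfield Y ->
  smooth_vfield (bracket X Y).
Proof.
move=> sX sY; rewrite (bracketE sX sY).
exact: smooth_vfieldB (smooth_nabla sX sY) (smooth_nabla sY sX).
Qed.

Lemma fderive_bracket X Y f : smooth_vfield X -> smooth_vfield Y -> smooth f ->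
  fderive (bracket X Y) f =
  fun x => fderive X (fderive Y f) x - fderive Y (fderive X f) x.
Proof.
move=> sX sY sf; rewrite bracketE //; have [_ h] := nabla_torsion_free LC sX sY.
by apply/funext => x; apply: h.
Qed.

Lemma fderiveD X f (f' : K -> R) : smooth f -> smooth f' ->
  fderive X (fun y => f y + f' y) = fun y => fderive X f y + fderive X f' y.
Proof. by move=> sf sf'; apply/funext => y; apply: tderiveD. Qed.

Lemma fderiveB X f (f' : K -> R) : smooth f -> smooth f' ->
  fderive X (fun y => f y - f' y) = fun y => fderive X f y - fderive X f' y.
Proof.
move=> sf sf'; apply/funext => y.
have := tderiveD y (X y) (smoothB sf sf') sf'.
by under [X in tderive _ _ X]eq_fun do rewrite subrK; rewrite /fderive => ->; rewrite addrK.
Qed.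

(** Each iterated bracket acts on a function by four triple derivatives, and the
    twelve cancel in pairs. *)
Lemma jacobi X Y Z x : smooth_vfield X -> smooth_vfield Y -> smooth_vfield Z ->
  bracket X (bracket Y Z) x + bracket Y (bracket Z X) x + bracket Z (bracket X Y) x = 0.
Proof.
move=> sX sY sZ; apply: (@tderive_inj _ _ K x) => f sf.
have tD u v : tderive x (u + v) f = tderive x u f + tderive x v f.
  by have := tderive_lin x 1 u v sf; rewrite scale1r mul1r.
rewrite !tD [RHS](_ : _ = 0); last exact: derive0.
have e U V W : smooth_vfield U -> smooth_vfield V -> smooth_vfield W ->
    tderive x (bracket U (bracket V W) x) f =
    fderive U (fderive V (fderive W f)) x - fderive U (fderive W (fderive V f)) x -
    (fderive V (fderive W (fderive U f)) x - fderive W (fderive V (fderive U f)) x).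
  move=> sU sV sW; change (fderive (bracket U (bracket V W)) f x = 
    fderive U (fderive V (fderive W f)) x - fderive U (fderive W (fderive V f)) x -
    (fderive V (fderive W (fderive U f)) x - fderive W (fderive V (fderive U f)) x)).
  have sVW := smooth_bracket sV sW.
  rewrite !fderive_bracket //; last exact: sU.
  by rewrite fderiveB //; [apply/sV/sW|apply/sW/sV].
have alg (a b c d k l : R) :
  a - b - (c - d) + (c - k - (l - b)) + (l - d - (a - k)) = 0 by ring.
have eqs := congr2 +%R (congr2 +%R (e _ _ _ sX sY sZ) (e _ _ _ sY sZ sX)) (e _ _ _ sZ sX sY).
exact: (etrans eqs (alg _ _ _ _ _ _)).
Qed.

Lemma curvature_vfieldN X Y Z x :
  smooth_vfield X -> smooth_vfield Y -> smooth_vfield Z ->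
  curvature_vfield X Y Z x = - curvature_vfield Y X Z x.
Proof.
move=> sX sY sZ; rewrite /curvature_vfield !bracketE //.
have sXY := smooth_nabla sX sY; have sYX := smooth_nabla sY sX.
by rewrite !nablaB_l //; apply/rowP => i; rewrite !mxE; ring.
Qed.

Lemma curvature_vfield_comb1 f X X' Y Z x : smooth f ->
  smooth_vfield X -> smooth_vfield X' -> smooth_vfield Y -> smooth_vfield Z ->
  curvature_vfield (fun y => f y *: X y + X' y) Y Z x =
  f x *: curvature_vfield X Y Z x + curvature_vfield X' Y Z x.
Proof.
move=> sf sX sX' sY sZ; have sc := smooth_vfield_comb sf sX sX'.
have sXZ := smooth_nabla sX sZ; have sX'Z := smooth_nabla sX' sZ.
have sYZ := smooth_nabla sY sZ.
have sB := smooth_bracket sX sY; have sB' := smooth_bracket sX' sY.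
have eB : bracket (fun y => f y *: X y + X' y) Y = fun y => f y *: bracket X Y y +
    ((- 1 * fderive Y f y) *: X y + bracket X' Y y).
  rewrite !bracketE // nabla_comb_l // nabla_comb_r //.
  by apply/funext => y; apply/rowP => i; rewrite !mxE; ring.
have sYf : smooth (fun y => - 1 * fderive Y f y).
  by apply: smoothM (smooth_cst _) _; apply: sY.
have sB2 := smooth_vfield_comb sYf sX sB'.
rewrite /curvature_vfield eB !nabla_comb_l // nabla_comb_r //.
generalize (fderive Y f x) (f x) (nabla X (nabla Y Z) x) (nabla X' (nabla Y Z) x)
  (nabla Y (nabla X Z) x) (nabla Y (nabla X' Z) x) (nabla X Z x)
  (nabla (bracket X Y) Z x) (nabla (bracket X' Y) Z x) => *.
by apply/rowP => i; rewrite !mxE; ring.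
Qed.

Lemma curvature_vfield_comb2 f X Y Y' Z x : smooth f ->
  smooth_vfield X -> smooth_vfield Y -> smooth_vfield Y' -> smooth_vfield Z ->
  curvature_vfield X (fun y => f y *: Y y + Y' y) Z x =
  f x *: curvature_vfield X Y Z x + curvature_vfield X Y' Z x.
Proof.
move=> sf sX sY sY' sZ; have sc := smooth_vfield_comb sf sY sY'.
rewrite curvature_vfieldN // curvature_vfield_comb1 //.
by rewrite (curvature_vfieldN _ sY) // (curvature_vfieldN _ sY') // scalerN opprD !opprK.
Qed.

Lemma curvature_vfield_comb3 f X Y Z Z' x : smooth f ->
  smooth_vfield X -> smooth_vfield Y -> smooth_vfield Z -> smooth_vfield Z' ->
  curvature_vfield X Y (fun y => f y *: Z y + Z' y) x =
  f x *: curvature_vfield X Y Z x + curvature_vfield X Y Z' x.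
Proof.
move=> sf sX sY sZ sZ'.
have sB := smooth_bracket sX sY.
have e U V : smooth_vfield U -> smooth_vfield V ->
    nabla U (nabla V (fun y => f y *: Z y + Z' y)) x =
    f x *: nabla U (nabla V Z) x + fderive U f x *: nabla V Z x +
    fderive V f x *: nabla U Z x + fderive U (fderive V f) x *: Z x +
    nabla U (nabla V Z') x.
  move=> sU sV; have sVf := sV f sf.
  have sVZ := smooth_nabla sV sZ; have sVZ' := smooth_nabla sV sZ'.
  have sc := smooth_vfield_comb sVf sZ sVZ'.
  by rewrite !nabla_comb_r //; apply/rowP => i; rewrite !mxE; ring.
rewrite /curvature_vfield !e // nabla_comb_r // fderive_bracket //.
generalize (fderive X (fderive Y f) x) (fderive Y (fderive X f) x)
  (fderive X f x) (fderive Y f x) (f x) (nabla X (nabla Y Z) x)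
  (nabla Y (nabla X Z) x) (nabla X (nabla Y Z') x) (nabla Y (nabla X Z') x)
  (nabla X Z x) (nabla Y Z x) (nabla (bracket X Y) Z x)
  (nabla (bracket X Y) Z' x) => *.
by apply/rowP => i; rewrite !mxE; ring.
Qed.

(** Without torsion, the cyclic sum of the curvature is the cyclic sum of
    iterated brackets. *)
Lemma curvature_vfield_bianchi X Y Z x :
  smooth_vfield X -> smooth_vfield Y -> smooth_vfield Z ->
  curvature_vfield X Y Z x + curvature_vfield Y Z X x + curvature_vfield Z X Y x = 0.
Proof.
move=> sX sY sZ.
have e U V W : smooth_vfield U -> smooth_vfield V -> smooth_vfield W ->
    bracket U (bracket V W) x = nabla U (nabla V W) x - nabla U (nabla W V) x -
      nabla (bracket V W) U x.
  move=> sU sV sW; rewrite (bracketE sU (smooth_bracket sV sW)).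
  congr (_ - _); rewrite bracketE //.
  have sVW := smooth_nabla sV sW; have sWV := smooth_nabla sW sV.
  have := nabla_comb_r (smooth_cst (-1)) sU sWV sVW.
  under [X in nabla U X]eq_fun do rewrite scaleN1r addrC.
  move=> ->; rewrite scaleN1r [fderive _ _ _](_ : _ = 0) ?scale0r ?add0r 1?addrC //.
  exact: (derive_cst (-1 : R)).
rewrite -(jacobi x sX sY sZ) !e // /curvature_vfield.
by apply/rowP => i; rewrite !mxE; ring.
Qed.

(** Both terms of [X,Y] g(Z,W) = X(Y g(Z,W)) - Y(X g(Z,W)) are expanded by
    compatibility with the metric; the mixed terms g(nabla_X Z, nabla_Y W) are
    symmetric in X and Y and cancel. *)
Lemma curvature_vfield_skew X Y Z W x :
  smooth_vfield X -> smooth_vfield Y -> smooth_vfield Z -> smooth_vfield W ->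
  g x (curvature_vfield X Y Z x) (W x) = - g x (curvature_vfield X Y W x) (Z x).
Proof.
move=> sX sY sZ sW.
have sB := smooth_bracket sX sY.
pose q (y : K) := g y (Z y) (W y).
have sq : smooth q by apply: smooth_g.
have d U V V' : smooth_vfield U -> smooth_vfield V -> smooth_vfield V' ->
    fderive U (fun y => g y (V y) (V' y)) =
    fun y => g y (nabla U V y) (V' y) + g y (V y) (nabla U V' y).
  by move=> sU sV sV'; apply/funext => y; apply: (nabla_metric LC).
have d2 U V : smooth_vfield U -> smooth_vfield V -> fderive U (fderive V q) x =
    g x (nabla U (nabla V Z) x) (W x) + g x (nabla V Z x) (nabla U W x) +
    (g x (nabla U Z x) (nabla V W x) + g x (Z x) (nabla U (nabla V W) x)).
  move=> sU sV; have sVZ := smooth_nabla sV sZ; have sVW := smooth_nabla sV sW.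
  rewrite /q d // fderiveD; try exact: smooth_g.
  by rewrite !d.
have := d _ _ _ sB sZ sW => /(congr1 (fun F => F x)).
rewrite -/q fderive_bracket // !d2 //.
have gB u v w : g x (u - v) w = g x u w - g x v w.
  by rewrite addrC -scaleN1r g_lin mulN1r addrC.
rewrite /curvature_vfield !gB (gC x (Z x)) (gC x (Z x)) (gC x (Z x)).
move/eqP; rewrite -subr_eq0 => /eqP h; apply/eqP; rewrite -subr_eq0 -h.
by apply/eqP; ring.
Qed.

Lemma curvature_vfield_J X Y Z x :
  smooth_vfield X -> smooth_vfield Y -> smooth_vfield Z ->
  curvature_vfield X Y (fun y => Z y *m J y) x = curvature_vfield X Y Z x *m J x.
Proof.
move=> sX sY sZ; have sB := smooth_bracket sX sY.
have e U V : smooth_vfield U -> smooth_vfield V ->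
    nabla U (fun y => V y *m J y) = fun y => nabla U V y *m J y.
  by move=> sU sV; apply/funext => y; apply: J_parallel.
have sYZ := smooth_nabla sY sZ; have sXZ := smooth_nabla sX sZ.
by rewrite /curvature_vfield !e // !mulmxBl.
Qed.

(** Tensoriality is used in one slot at a time to replace the chosen extensions
    by the given fields. *)
Lemma RmE X Y Z x w : smooth_vfield X -> smooth_vfield Y -> smooth_vfield Z ->
  Rm x (X x) (Y x) (Z x) w = g x (curvature_vfield X Y Z x) w.
Proof.
move=> sX sY sZ; rewrite /Rm.
have [sX' X'x] := @extensionP _ _ K x (X x).
have [sY' Y'x] := @extensionP _ _ K x (Y x).
have [sZ' Z'x] := @extensionP _ _ K x (Z x).
congr (g x _ w).
rewrite (@tensorial _ _ K _ (fun U =>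
  curvature_vfield U (extension x (Y x)) (extension x (Z x)) x) x _ _ X) //; last first.
  by move=> *; apply: curvature_vfield_comb1.
rewrite (@tensorial _ _ K _ (fun U =>
  curvature_vfield X U (extension x (Z x)) x) x _ _ Y) //; last first.
  by move=> *; apply: curvature_vfield_comb2.
rewrite (@tensorial _ _ K _ (fun U => curvature_vfield X Y U x) x _ _ Z) //.
by move=> *; apply: curvature_vfield_comb3.
Qed.

End Connection.

(** * Curvature tensors of Kaehler type *)

Section LinearMaps.
Context {R : realType} {V : lmodType R} (f : V -> V).
Hypothesis flin : forall (a : R) u v, f (a *: u + v) = a *: f u + f v.

Lemma linmap0 : f 0 = 0.
Proof. by have := flin (-1) 0 0; rewrite scaleN1r oppr0 addr0 scaleN1r addNr. Qed.
Lemma linmapN u : f (- u) = - f u.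
Proof. by have := flin (-1) u 0; rewrite !scaleN1r linmap0 !addr0. Qed.
Lemma linmapD u v : f (u + v) = f u + f v.
Proof. by have := flin 1 u v; rewrite !scale1r. Qed.
Lemma linmapZ a u : f (a *: u) = a *: f u.
Proof. by have := flin a u 0; rewrite linmap0 !addr0. Qed.

End LinearMaps.

Section KaehlerCurvature.
Context {R : realType} {V : lmodType R}.
Implicit Types (J : V -> V) (T S : V -> V -> V -> V -> R).

Record kaehler_curvature J T : Prop := KaehlerCurvature {
  kc_lin : forall a u v y z w, T (a *: u + v) y z w = a * T u y z w + T v y z w ;
  kc_skew12 : forall x y z w, T x y z w = - T y x z w ;
  kc_skew34 : forall x y z w, T x y z w = - T x y w z ;
  kc_bianchi : forall x y z w, T x y z w + T y z x w + T z x y w = 0 ;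
  kc_J : forall x y z w, T x y (J z) (J w) = T x y z w }.

Lemma kaehler_curvature_comb J T S (a : R) :
  kaehler_curvature J T -> kaehler_curvature J S ->
  kaehler_curvature J (fun x y z w => a * T x y z w + S x y z w).
Proof.
move=> kT kS; split.
- by move=> *; rewrite (kc_lin kT) (kc_lin kS); ring.
- by move=> *; rewrite [in LHS](kc_skew12 kT) [in LHS](kc_skew12 kS); ring.
- by move=> *; rewrite [in LHS](kc_skew34 kT) [in LHS](kc_skew34 kS); ring.
- move=> x y z w; have := kc_bianchi kT x y z w; have := kc_bianchi kS x y z w.
  by move=> hS hT; transitivity (a * 0 + 0 : R); [rewrite -{1}hT -hS|]; ring.
- by move=> *; rewrite (kc_J kT) (kc_J kS).
Qed.

Section Polarization.
Variables (J : V -> V) (T : V -> V -> V -> V -> R).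
Hypothesis kT : kaehler_curvature J T.
Hypothesis Jlin : forall a u v, J (a *: u + v) = a *: J u + J v.
Hypothesis JJ : forall u, J (J u) = - u.

(** The four Bianchi identities on the faces of an octahedron whose vertices are
    the six ways to split the arguments into ordered pairs. *)
Lemma kc_pair x y z w : T x y z w = T z w x y.
Proof.
have b := kc_bianchi kT; have s := kc_skew12 kT; have t := kc_skew34 kT.
have := b w x y z; have := b z w x y; have := b y z w x; have := b x y z w.
rewrite (s z x y w) (t y z w x) (t z w y x) (s w y z x) (t y w z x).
rewrite (s w x z y) (t x w z y) (t x z w y) (s w x y z) (t x y w z).
lra.
Qed.

Lemma kcD1 u v y z w : T (u + v) y z w = T u y z w + T v y z w.
Proof. by have := kc_lin kT 1 u v y z w; rewrite scale1r mul1r. Qed.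
Lemma kc01 y z w : T 0 y z w = 0.
Proof.
by have := kcD1 0 0 y z w; rewrite addr0 => /eqP; rewrite -subr_eq subrr eq_sym => /eqP.
Qed.
Lemma kcZ1 a u y z w : T (a *: u) y z w = a * T u y z w.
Proof. by have := kc_lin kT a u 0 y z w; rewrite addr0 kc01 addr0. Qed.
Lemma kcN1 u y z w : T (- u) y z w = - T u y z w.
Proof. by rewrite -scaleN1r kcZ1 mulN1r. Qed.
Lemma kcD2 x u v z w : T x (u + v) z w = T x u z w + T x v z w.
Proof. by rewrite (kc_skew12 kT) kcD1 opprD -!(kc_skew12 kT). Qed.
Lemma kcZ2 x a u z w : T x (a *: u) z w = a * T x u z w.
Proof. by rewrite (kc_skew12 kT) kcZ1 -mulrN -(kc_skew12 kT). Qed.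
Lemma kcN2 x u z w : T x (- u) z w = - T x u z w.
Proof. by rewrite -scaleN1r kcZ2 mulN1r. Qed.
Lemma kcD3 x y u v w : T x y (u + v) w = T x y u w + T x y v w.
Proof. by rewrite kc_pair kcD1 -!(kc_pair x y). Qed.
Lemma kcZ3 x y a u w : T x y (a *: u) w = a * T x y u w.
Proof. by rewrite kc_pair kcZ1 -(kc_pair x y). Qed.
Lemma kcN3 x y u w : T x y (- u) w = - T x y u w.
Proof. by rewrite -scaleN1r kcZ3 mulN1r. Qed.
Lemma kcD4 x y z u v : T x y z (u + v) = T x y z u + T x y z v.
Proof. by rewrite kc_pair kcD2 -!(kc_pair x y). Qed.
Lemma kcZ4 x y z a u : T x y z (a *: u) = a * T x y z u.
Proof. by rewrite kc_pair kcZ2 -(kc_pair x y). Qed.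
Lemma kcN4 x y z u : T x y z (- u) = - T x y z u.
Proof. by rewrite -scaleN1r kcZ4 mulN1r. Qed.

Definition kcE := (kcD1, kcD2, kcD3, kcD4, kcZ1, kcZ2, kcZ3, kcZ4,
  kcN1, kcN2, kcN3, kcN4).

Lemma kc_J12 x y z w : T (J x) (J y) z w = T x y z w.
Proof. by rewrite kc_pair (kc_J kT) -kc_pair. Qed.

Lemma kc_J4 x y z w : T x y z (J w) = - T x y (J z) w.
Proof. by rewrite -(kc_J kT) JJ kcN4. Qed.

Lemma kc_J2 x y z w : T x (J y) z w = - T (J x) y z w.
Proof. by rewrite -kc_J12 JJ kcN2. Qed.

(** The form (x,y,z,w) |-> T(x,Jy,Jz,w) has three distinct rearrangements, so
    its vanishing on the diagonal is a relation between two of them; the Bianchi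
    identity and the substitution y |-> Jy turn it into T(x,y,x,y) = 9
    T(x,y,x,y), and a tensor without sectional curvature is 0. *)
Lemma kc_polarization : (forall x, T x (J x) (J x) x = 0) -> forall x y z w, T x y z w = 0.
Proof.
move=> H0.
pose Q x y z w := T x (J y) (J z) w.
have Q12 x y z w : Q x y z w = Q y x z w.
  by rewrite /Q kc_J2 (kc_skew12 kT) opprK.
have Q34 x y z w : Q x y z w = Q x y w z.
  by rewrite /Q (kc_skew34 kT) kc_J4 opprK.
have Q14 x y z w : Q x y z w = Q w z y x.
  by rewrite /Q kc_pair (kc_skew12 kT) (kc_skew34 kT) opprK.
have e1 x y : Q x x y y = - 2 * Q x y x y.
  have := H0 (x + y); have := H0 (x - y); have := H0 x; have := H0 y.
  rewrite !(linmapD Jlin, linmapN Jlin) !kcE -!/(Q _ _ _ _).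
  have := Q12 x y y x; have := Q34 x y x y; have := Q12 x y x y.
  have := Q34 y x x y; have := Q14 x x y y.
  lra.
have e2 x y : T x y x y = 3 * Q x y x y.
  have := kc_bianchi kT x (J x) (J y) y.
  rewrite kc_J12 (kc_skew12 kT (J y)) -!/(Q _ _ _ _) e1.
  lra.
have e3 x y : T x y x y = 0.
  have := e2 x (J y); have := e2 x y.
  rewrite /Q JJ kcN2 (kc_J kT) kc_J4.
  lra.
have e4 x y w : T x y x w = 0.
  by have := e3 x (y + w); rewrite !kcE !e3 (kc_pair x w); lra.
have e5 x y z w : T x y z w = - T z y x w.
  by have := e4 (x + z) y w; rewrite !kcE !e4; lra.
move=> x y z w; have := kc_bianchi kT x y z w.
have := e5 y z x w; have := e5 z x y w; have := kc_skew12 kT x y z w.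
have := kc_skew12 kT x z y w; have := e5 x y z w; have := kc_skew12 kT z y x w.
lra.
Qed.

End Polarization.
End KaehlerCurvature.

(** * Hermitian forms and the curvature tensors built from them *)

Section HermitianForms.
Context {R : realType} {V : lmodType R}.
Implicit Types (J P : V -> V) (g h : V -> V -> R).

Record hermitian J g : Prop := Hermitian {
  herm_lin : forall a u v w, g (a *: u + v) w = a * g u w + g v w ;
  herm_sym : forall u v, g u v = g v u ;
  herm_J : forall u v, g (J u) (J v) = g u v }.

(** The symmetric bilinear expression in two Hermitian forms which is Pi for [h
    = g] and Phi for [h] the restriction of [g] to a subspace. *)
Definition mixed_curvature J g h (x y z u : V) : R :=
  8^-1 * (g y z * h x u - g x z * h y u + g x u * h y z - g y u * h x z
          + g (J y) z * h (J x) u - g (J x) z * h (J y) u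
          + g (J x) u * h (J y) z - g (J y) u * h (J x) z
          - 2 * (g (J x) y * h (J z) u) - 2 * (g (J z) u * h (J x) y)).

Definition square_curvature J h (x y z u : V) : R := - (h (J x) y * h (J z) u).

Section Facts.
Variables (J : V -> V) (g : V -> V -> R).
Hypothesis JJ : forall u, J (J u) = - u.
Hypothesis hg : hermitian J g.

Lemma hermD u v w : g (u + v) w = g u w + g v w.
Proof. by have := herm_lin hg 1 u v w; rewrite scale1r mul1r. Qed.
Lemma herm0 w : g 0 w = 0.
Proof. by have := hermD 0 0 w; rewrite addr0 => /eqP; rewrite -subr_eq subrr eq_sym => /eqP. Qed.
Lemma hermZ a u w : g (a *: u) w = a * g u w.
Proof. by have := herm_lin hg a u 0 w; rewrite addr0 herm0 addr0. Qed.
Lemma hermN u w : g (- u) w = - g u w.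
Proof. by rewrite -scaleN1r hermZ mulN1r. Qed.
Lemma hermDr w u v : g w (u + v) = g w u + g w v.
Proof. by rewrite (herm_sym hg) hermD !(herm_sym hg w). Qed.
Lemma hermZr w a u : g w (a *: u) = a * g w u.
Proof. by rewrite (herm_sym hg) hermZ (herm_sym hg w). Qed.
Lemma hermNr w u : g w (- u) = - g w u.
Proof. by rewrite (herm_sym hg) hermN (herm_sym hg w). Qed.
Lemma hermJr u v : g u (J v) = - g (J u) v.
Proof. by rewrite -(herm_J hg u) JJ hermNr. Qed.
Lemma hermJ_skew u v : g (J u) v = - g (J v) u.
Proof. by rewrite -hermJr (herm_sym hg). Qed.
Lemma hermJ_self u : g (J u) u = 0.
Proof. by have := hermJ_skew u u; lra. Qed.

Lemma herm_normalize u : 0 < g u u ->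
  exists s : R, [/\ s != 0, s ^+ 2 = g u u & g (s^-1 *: u) (s^-1 *: u) = 1].
Proof.
move=> u0; exists (Num.sqrt (g u u)); set s := Num.sqrt _.
have s0 : s != 0 by rewrite gt_eqF // sqrtr_gt0.
have ss : s ^+ 2 = g u u by rewrite sqr_sqrtr // ltW.
by split=> //; rewrite hermZ hermZr -ss; field.
Qed.
End Facts.

Section Tensors.
Variables (J : V -> V) (g h : V -> V -> R).
Hypothesis Jlin : forall a u v, J (a *: u + v) = a *: J u + J v.
Hypothesis JJ : forall u, J (J u) = - u.
Hypothesis hg : hermitian J g.
Hypothesis hh : hermitian J h.

Lemma mixed_kaehler_curvature : kaehler_curvature J (mixed_curvature J g h).
Proof.
have gs := herm_sym hg; have hs := herm_sym hh.
have gk := hermJ_skew JJ hg; have hk := hermJ_skew JJ hh.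
have gr := hermJr JJ hg; have hr := hermJr JJ hh.
split; rewrite /mixed_curvature.
- by move=> a u v y z w; rewrite !Jlin !(herm_lin hg) !(herm_lin hh); ring.
- by move=> x y z w; rewrite (gk y x) (hk y x); ring.
- by move=> x y z w; rewrite (gk w z) (hk w z); ring.
- move=> x y z w.
  rewrite (gs z x) (hs z x) (gs z y) (hs z y) (gs y x) (hs y x).
  by rewrite (gk z x) (hk z x) (gk z y) (hk z y) (gk y x) (hk y x); ring.
- move=> x y z w; rewrite !(herm_J hg) !(herm_J hh) !gr !hr.
  by ring.
Qed.

(** The Bianchi identity for the square of a 2-form is its decomposability. *)
Lemma square_kaehler_curvature :
  (forall x y z u, h (J x) y * h (J z) u + h (J y) z * h (J x) u +
                   h (J z) x * h (J y) u = 0) ->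
  kaehler_curvature J (square_curvature J h).
Proof.
move=> dec; have hk := hermJ_skew JJ hh; have hr := hermJr JJ hh.
split; rewrite /square_curvature.
- by move=> a u v y z w; rewrite !Jlin !(herm_lin hh); ring.
- by move=> x y z w; rewrite (hk y x); ring.
- by move=> x y z w; rewrite (hk w z); ring.
- by move=> x y z w; rewrite -!opprD dec oppr0.
- by move=> x y z w; rewrite !hr JJ !(hermN hh) opprK.
Qed.

Lemma mixed_holomorphic x : mixed_curvature J g h x (J x) (J x) x = g x x * h x x.
Proof.
have gr := hermJr JJ hg; have hr := hermJr JJ hh.
rewrite /mixed_curvature !JJ !(hermN hg) !(hermN hh) !(herm_J hg) !(herm_J hh).
rewrite !gr !hr !(hermJ_self JJ hg) !(hermJ_self JJ hh).
by field.
Qed.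

Lemma square_holomorphic x : square_curvature J h x (J x) (J x) x = h x x ^+ 2.
Proof.
by rewrite /square_curvature (hermJr JJ hh) JJ !(hermN hh); ring.
Qed.

Definition derivation (L : V -> V) (T : V -> V -> V -> V -> R) x y z w :=
  T (L x) y z w + T x (L y) z w + T x y (L z) w + T x y z (L w).

(** Every factor g(.,.), h(.,.), g(J.,.), h(J.,.) is preserved, so the
    contributions of the two slots of each factor cancel. *)
Lemma mixed_derivation (L : V -> V) :
  (forall x y, g (L x) y = - g x (L y)) ->
  (forall x y, h (L x) y = - h x (L y)) ->
  (forall x y, g (J (L x)) y = - g (J x) (L y)) ->
  (forall x y, h (J (L x)) y = - h (J x) (L y)) ->
  forall x y z w, derivation L (mixed_curvature J g h) x y z w = 0.
Proof.
move=> Lg Lh LgJ LhJ x y z w; rewrite /derivation /mixed_curvature.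
by rewrite !(Lg, Lh, LgJ, LhJ); ring.
Qed.

Lemma square_derivation (L : V -> V) :
  (forall x y, h (J (L x)) y = - h (J x) (L y)) ->
  forall x y z w, derivation L (square_curvature J h) x y z w = 0.
Proof.
move=> LhJ x y z w; rewrite /derivation /square_curvature.
by rewrite !LhJ; ring.
Qed.

End Tensors.

Section Projection.
Variables (J P : V -> V) (g : V -> V -> R).
Hypothesis Jlin : forall a u v, J (a *: u + v) = a *: J u + J v.
Hypothesis JJ : forall u, J (J u) = - u.
Hypothesis hg : hermitian J g.
Hypothesis Plin : forall a u v, P (a *: u + v) = a *: P u + P v.
Hypothesis PP : forall u, P (P u) = P u.
Hypothesis PJ : forall u, P (J u) = J (P u).
Hypothesis gP : forall u v, g (P u) v = g u (P v).

Definition restriction u v := g (P u) (P v).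
Local Notation h := restriction.

Lemma restrictionE u v : h u v = g (P u) v.
Proof. by rewrite /h -gP PP. Qed.

Lemma hermitian_restriction : hermitian J h.
Proof.
split; rewrite /h.
- by move=> *; rewrite Plin (herm_lin hg).
- by move=> *; rewrite (herm_sym hg).
- by move=> *; rewrite !PJ (herm_J hg).
Qed.

(** In terms of g = h + k, Phi - Pi/2 is half the difference of the tensors Pi
    of h and k: it has no mixed terms and preserves both subspaces. *)
Definition split_curvature (b c : R) x y z w :=
  b * (mixed_curvature J g h x y z w - 2^-1 * mixed_curvature J g g x y z w) +
  c * square_curvature J h x y z w.

Lemma split_curvature_skew b c u v x y :
  split_curvature b c u v x y = - split_curvature b c u v y x.
Proof.
have hh := hermitian_restriction.
have gk := hermJ_skew JJ hg; have hk := hermJ_skew JJ hh.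
rewrite /split_curvature /mixed_curvature /square_curvature.
by rewrite (gk y x) (hk y x); ring.
Qed.

Lemma split_curvature_J b c u v x y :
  split_curvature b c u v x (J y) = split_curvature b c u v y (J x).
Proof.
have hh := hermitian_restriction.
have gs := herm_sym hg; have hs := herm_sym hh.
have gk := hermJ_skew JJ hg; have hk := hermJ_skew JJ hh.
have gr := hermJr JJ hg; have hr := hermJr JJ hh.
rewrite /split_curvature /mixed_curvature /square_curvature.
rewrite !(gr, hr) !JJ !(hermN hg) !(hermN hh) (gs y x) (hs y x).
by field.
Qed.

(** This is where the absence of mixed terms is used: both sides only involve
    the part of the tensor built from [h]. *)
Lemma split_curvature_P b c u v x y :
  split_curvature b c u v x (P y) = - split_curvature b c u v y (P x).
Proof.
have hh := hermitian_restriction.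
have gs := herm_sym hg; have hs := herm_sym hh.
have gk := hermJ_skew JJ hg; have hk := hermJ_skew JJ hh.
have gr u' v' : g u' (P v') = h u' v' by rewrite restrictionE gP.
have hr u' v' : h u' (P v') = h u' v' by rewrite /h PP.
rewrite /split_curvature /mixed_curvature /square_curvature.
rewrite !(gr, hr) (hk y x).
by field.
Qed.

Lemma split_curvature_PJ b c u v x y :
  split_curvature b c u v x (P (J y)) = split_curvature b c u v y (P (J x)).
Proof. by rewrite split_curvature_P split_curvature_skew opprK split_curvature_J PJ. Qed.

End Projection.
End HermitianForms.

(** * Holomorphic sectional curvature depending only on the norm of the projection *)

Section HolomorphicCurvature.
Context {R : realType} {V : lmodType R}.
Variables (J P : V -> V) (g : V -> V -> R) (T : V -> V -> V -> V -> R).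
Hypothesis Jlin : forall a u v, J (a *: u + v) = a *: J u + J v.
Hypothesis JJ : forall u, J (J u) = - u.
Hypothesis hg : hermitian J g.
Hypothesis gpos : forall u, u != 0 -> 0 < g u u.
Hypothesis Plin : forall a u v, P (a *: u + v) = a *: P u + P v.
Hypothesis PP : forall u, P (P u) = P u.
Hypothesis PJ : forall u, P (J u) = J (P u).
Hypothesis gP : forall u v, g (P u) v = g u (P v).
Hypothesis kT : kaehler_curvature J T.
Local Notation h := (restriction P g).
Let hh := hermitian_restriction hg Plin PJ.
Hypothesis dec : forall x y z u, h (J x) y * h (J z) u +
  h (J y) z * h (J x) u + h (J z) x * h (J y) u = 0.

Definition holomorphic x := T x (J x) (J x) x.

Definition qch_model (a b c : R) x y z w :=
  a * mixed_curvature J g g x y z w +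
  (b * mixed_curvature J g h x y z w + c * square_curvature J h x y z w).

(** The difference of the two tensors is of Kaehler type with zero holomorphic
    curvature. *)
Lemma qch_modelP a b c :
  (forall x, holomorphic x = a * g x x ^+ 2 + b * (g x x * h x x) + c * h x x ^+ 2) ->
  forall x y z w, T x y z w = qch_model a b c x y z w.
Proof.
move=> HT x y z w; apply/eqP; rewrite -subr_eq0; apply/eqP.
have k1 := mixed_kaehler_curvature Jlin JJ hg hg.
have k2 := mixed_kaehler_curvature Jlin JJ hg hh.
have k3 := square_kaehler_curvature Jlin JJ hh dec.
have kD := kaehler_curvature_comb (- a) k1 (kaehler_curvature_comb (- b) k2
  (kaehler_curvature_comb (- c) k3 kT)).
rewrite -[RHS](kc_polarization kD Jlin JJ _ x y z w); first by rewrite /qch_model; ring.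
move=> v; rewrite !(mixed_holomorphic JJ) // (square_holomorphic JJ hh).
by have := HT v; rewrite /holomorphic => ->; ring.
Qed.

Lemma holomorphicZ s x : holomorphic (s *: x) = s ^+ 4 * holomorphic x.
Proof. by rewrite /holomorphic !(linmapZ Jlin) !(kcE kT); ring. Qed.

Lemma holomorphic_plane e1 e2 : exists q4 q3 q2 q1 q0 : R, forall s t,
  holomorphic (s *: e1 + t *: e2) = q4 * s ^+ 4 + q3 * (s ^+ 3 * t) +
    q2 * (s ^+ 2 * t ^+ 2) + q1 * (s * t ^+ 3) + q0 * t ^+ 4.
Proof.
pose Q x y z w := T x (J y) (J z) w.
exists (Q e1 e1 e1 e1),
  (Q e2 e1 e1 e1 + Q e1 e2 e1 e1 + Q e1 e1 e2 e1 + Q e1 e1 e1 e2),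
  (Q e1 e1 e2 e2 + Q e1 e2 e1 e2 + Q e1 e2 e2 e1 +
   Q e2 e1 e1 e2 + Q e2 e1 e2 e1 + Q e2 e2 e1 e1),
  (Q e1 e2 e2 e2 + Q e2 e1 e2 e2 + Q e2 e2 e1 e2 + Q e2 e2 e2 e1),
  (Q e2 e2 e2 e2) => s t.
by rewrite /holomorphic !(linmapD Jlin) !(linmapZ Jlin) !(kcE kT) /Q; ring.
Qed.

Variable phi : R -> R.
Hypothesis Tphi : forall x, g x x = 1 -> holomorphic x = phi (Num.sqrt (h x x)).

(** A curvature quantity homogeneous of degree 4 is known on unit vectors. *)
Lemma holomorphic_homogeneous (a b c : R) :
  (forall x, g x x = 1 -> holomorphic x = a + b * h x x + c * h x x ^+ 2) ->
  forall x, holomorphic x = a * g x x ^+ 2 + b * (g x x * h x x) + c * h x x ^+ 2.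
Proof.
move=> Hunit x; have [->|x0] := eqVneq x 0.
  have -> : (0 : V) = 0 *: 0 by rewrite scaler0.
  by rewrite holomorphicZ !(hermZ hg) !(hermZ hh); ring.
have [s [s0 _ y1]] := herm_normalize hg (gpos x0).
have -> : x = s *: (s^-1 *: x) by rewrite scalerA divff // scale1r.
move: (s^-1 *: x) y1 => y y1.
rewrite holomorphicZ Hunit // !(hermZ hg) !(hermZr hg) !(hermZ hh) !(hermZr hh) y1.
by ring.
Qed.

Lemma holomorphic_full : (forall x, P x = x) ->
  forall x, holomorphic x = 0 * g x x ^+ 2 + 0 * (g x x * h x x) + phi 1 * h x x ^+ 2.
Proof.
move=> P1; apply: holomorphic_homogeneous => x x1.
have h1 : h x x = 1 by rewrite /restriction P1.
by rewrite Tphi // h1 sqrtr1; ring.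
Qed.

(** On the plane of e1 and e2 the curvature is a quartic form in (s, t), even in
    t because the projection of s e1 + t e2 has norm |s|. A unit vector x has
    the same projected norm as s e1 + t e2 for s^2 = h(x,x) and t^2 = 1 -
    h(x,x), so its curvature is that quartic form in s^2 and 1 - s^2. *)
Lemma holomorphic_split e1 e2 : P e1 = e1 -> P e2 = 0 -> g e1 e1 = 1 -> g e2 e2 = 1 ->
  exists a b c : R, forall x,
    holomorphic x = a * g x x ^+ 2 + b * (g x x * h x x) + c * h x x ^+ 2.
Proof.
move=> P1 P2 g11 g22.
have g12 : g e1 e2 = 0 by rewrite -P1 gP P2 -[0](scaler0 _ 0) (hermZr hg) mul0r.
have g21 : g e2 e1 = 0 by rewrite (herm_sym hg).
have gst s t : g (s *: e1 + t *: e2) (s *: e1 + t *: e2) = s ^+ 2 + t ^+ 2.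
  rewrite !(hermD hg) !(hermDr hg) !(hermZ hg) !(hermZr hg) g11 g22 g12 g21.
  by ring.
have hst s t : h (s *: e1 + t *: e2) (s *: e1 + t *: e2) = s ^+ 2.
  have Pst : P (s *: e1 + t *: e2) = s *: e1.
    have P0 : P 0 = 0 by rewrite (linmap0 Plin).
    by rewrite Plin P1 (linmapZ Plin) P2 scaler0 addr0.
  by rewrite /restriction Pst (hermZ hg) (hermZr hg) g11; ring.
have [q4 [q3 [q2 [q1 [q0 q]]]]] := holomorphic_plane e1 e2.
have qphi s t : s ^+ 2 + t ^+ 2 = 1 -> phi `|s| = q4 * s ^+ 4 + q3 * (s ^+ 3 * t) +
    q2 * (s ^+ 2 * t ^+ 2) + q1 * (s * t ^+ 3) + q0 * t ^+ 4.
  by move=> st; rewrite -q Tphi ?gst // hst sqrtr_sqr.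
(* phi is even in t: two points of the unit circle kill both odd coefficients *)
have [q30 q10] : q3 = 0 /\ q1 = 0.
  have o s t : s ^+ 2 + t ^+ 2 = 1 -> q3 * (s ^+ 3 * t) + q1 * (s * t ^+ 3) = 0.
    move=> st; have := qphi s t st; have := qphi s (- t).
    by rewrite sqrrN => /(_ st) ->; lra.
  have := o (3 / 5) (4 / 5); have := o (4 / 5) (3 / 5).
  have -> : (3 / 5 : R) ^+ 2 + (4 / 5) ^+ 2 = 1 by field.
  have -> : (4 / 5 : R) ^+ 2 + (3 / 5) ^+ 2 = 1 by field.
  by move=> /(_ erefl) h1 /(_ erefl) h2; split; lra.
exists q0, (q2 - 2 * q0), (q4 - q2 + q0); apply: holomorphic_homogeneous => x x1.
have g0 u : 0 <= g u u.
  have [->|u0] := eqVneq u 0; last exact/ltW/gpos.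
  by rewrite (herm0 hg).
have h0 : 0 <= h x x by apply: g0.
have h1 : h x x <= 1.
  have : g x x = h x x + g (x - P x) (x - P x).
    have e : g x (P x) = h x x by rewrite /restriction gP PP.
    rewrite (hermD hg) !(hermDr hg) !(hermN hg) !(hermNr hg).
    have e' : g (P x) x = h x x by rewrite gP.
    rewrite e e' -/(h x x).
    by ring.
  by rewrite x1 => ->; rewrite lerDl.
have ss := sqr_sqrtr h0; have s0 := sqrtr_ge0 (h x x).
have tt : Num.sqrt (1 - h x x) ^+ 2 = 1 - h x x by rewrite sqr_sqrtr // subr_ge0.
rewrite Tphi // -(ger0_norm s0) (qphi _ (Num.sqrt (1 - h x x))); last by rewrite ss tt; ring.
rewrite q30 q10 !mul0r !addr0 -[4%N]/(2 * 2)%N !exprM ss tt.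
by ring.
Qed.

End HolomorphicCurvature.

(** * The tangent spaces of a Kaehler manifold *)

Section Pointwise.
Context {R : realType} {n : nat} {K : kahler R n}.
Local Notation TM := 'rV[R]_(2 * n).
Implicit Types (x : K) (u v w z : TM).

Definition Jop x (v : TM) : TM := v *m J x.

Lemma Jop_lin x (a : R) u v : Jop x (a *: u + v) = a *: Jop x u + Jop x v.
Proof. by rewrite /Jop mulmxDl scalemxAl. Qed.

Lemma JopK x u : Jop x (Jop x u) = - u.
Proof. by rewrite /Jop -mulmxA J_square mulmxN mulmx1. Qed.

Lemma g_hermitian x : hermitian (Jop x) (g x).
Proof.
split; [exact: g_lin|exact: gC|by move=> u v; apply: J_orthogonal].
Qed.

Lemma g_pos x u : u != 0 -> 0 < g x u u.
Proof. exact: (riem_pos (gram_riemannian K)). Qed.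

Lemma g_self0 x u : g x u u = 0 -> u = 0.
Proof. by move=> u0; apply/eqP/negP => /negP /(g_pos x); rewrite u0 ltxx. Qed.

(** A row in the kernel of the Gram matrix would have length 0. *)
Lemma gram_unit x : gram x \in unitmx.
Proof.
rewrite -row_free_unit -kermx_eq0; apply/eqP/row_matrixP => i.
rewrite row0; apply: (@g_self0 x); rewrite /g /inner.
by rewrite -row_mul mulmx_ker row0 mul0mx mxE.
Qed.

Lemma Rm_fields x (X Y Z : vfield K) u v w z :
  smooth_vfield X -> smooth_vfield Y -> smooth_vfield Z ->
  X x = u -> Y x = v -> Z x = w -> Rm x u v w z = g x (curvature_vfield X Y Z x) z.
Proof. by move=> sX sY sZ <- <- <-; apply: RmE. Qed.

Lemma Rm_kaehler_curvature x : kaehler_curvature (Jop x) (Rm x).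
Proof.
have sx := @extensionP R _ K x; have hg := g_hermitian x.
split=> [a u v y z w|y y' z w|y z w w'|u y z w|y z w w'].
- have [su eu] := sx u; have [sv ev] := sx v; have [sy ey] := sx y; have [sz ez] := sx z.
  have sc := smooth_vfield_comb (smooth_cst a) su sv.
  have ec : a *: extension x u x + extension x v x = a *: u + v by rewrite eu ev.
  rewrite (Rm_fields w su sy sz eu ey ez) (Rm_fields w sv sy sz ev ey ez).
  rewrite (Rm_fields w sc sy sz ec ey ez).
  by rewrite (curvature_vfield_comb1 x (smooth_cst a) su sv sy sz) g_lin.
- have [su eu] := sx y; have [sv ev] := sx y'; have [sz ez] := sx z.
  rewrite (Rm_fields w su sv sz eu ev ez) (Rm_fields w sv su sz ev eu ez).
  by rewrite (curvature_vfieldN x su sv sz) (hermN hg).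
- have [su eu] := sx y; have [sv ev] := sx z; have [sz ez] := sx w; have [sw ew] := sx w'.
  rewrite (Rm_fields w' su sv sz eu ev ez) (Rm_fields w su sv sw eu ev ew).
  by have := curvature_vfield_skew x su sv sz sw; rewrite ew ez.
- have [su eu] := sx u; have [sv ev] := sx y; have [sz ez] := sx z.
  rewrite (Rm_fields w su sv sz eu ev ez) (Rm_fields w sv sz su ev ez eu).
  rewrite (Rm_fields w sz su sv ez eu ev) -!(hermD hg).
  by rewrite (curvature_vfield_bianchi x su sv sz) (herm0 hg).
- have [su eu] := sx y; have [sv ev] := sx z; have [sz ez] := sx w.
  have sJ := J_smooth sz; have eJ : extension x w x *m J x = Jop x w by rewrite ez.
  rewrite (Rm_fields w' su sv sz eu ev ez) (Rm_fields _ su sv sJ eu ev eJ).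
  by rewrite (curvature_vfield_J x su sv sz) (herm_J hg).
Qed.

Lemma rank_complex_line x e : g x e e = 1 -> \rank (col_mx e (Jop x e)) = 2%N.
Proof.
have hg := g_hermitian x; move=> ee.
have eJe : g x (Jop x e) e = 0 by apply: hermJ_self (JopK x) hg e.
have Jee : g x e (Jop x e) = 0 by rewrite gC.
have JJ1 : g x (Jop x e) (Jop x e) = 1 by rewrite (herm_J hg).
pose M := col_mx e (Jop x e).
apply/eqP; apply/row_freeP; exists (gram x *m M^T).
rewrite mulmxA mul_col_mx tr_col_mx mul_col_row.
have g11 v w : v *m gram x *m w^T = (g x v w)%:M.
  by rewrite [LHS]mx11_scalar.
by rewrite !g11 ee JJ1 eJe Jee scalar_mx_block !raddf0.
Qed.

Lemma row_sum_linear (F : TM -> R) : (forall a u v, F (a *: u + v) = a * F u + F v) ->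
  forall w, F w = \sum_i w 0 i * F (delta_mx 0 i).
Proof.
move=> Fl w; have F0 : F 0 = 0.
  by have := Fl (-1) 0 0; rewrite scaleN1r oppr0 addr0 mulN1r addNr.
rewrite {1}(row_sum_delta w).
elim: (index_enum _) => [|i s IH]; first by rewrite !big_nil.
by rewrite !big_cons Fl IH.
Qed.

Lemma endoE (S : tensor4 K) x U V X W :
  (forall a u v, S x U V X (a *: u + v) = a * S x U V X u + S x U V X v) ->
  g x (endo S x U V X) W = S x U V X W.
Proof.
move=> Sl; rewrite /g /inner /endo mulmxKV ?gram_unit // mxE.
rewrite (row_sum_linear Sl W); apply: eq_bigr => i _.
by rewrite !mxE mulrC.
Qed.

Variable D : K -> 'M[R]_(2 * n).

Section AtPoint.
Variable x : K.
Hypothesis rkD : \rank (D x) = 2%N.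
Hypothesis stD : stablemx (D x) (J x).
Local Notation orthD := (kermx (gram x *m (D x)^T)).
Let hg := g_hermitian x.

Definition projD u : TM := u *m pD D x.
Local Notation P := projD.

Lemma sub_orthP u : reflect (forall w, (w <= D x)%MS -> g x u w = 0) (u <= orthD)%MS.
Proof.
apply: (iffP sub_kermxP) => [u0 w /submxP [c ->]|u0].
  by rewrite /g /inner trmx_mul !mulmxA -(mulmxA u) u0 mul0mx mxE.
apply/rowP => i; rewrite [RHS]mxE mulmxA.
have := u0 (row i (D x)) (row_sub _ _); rewrite /g /inner => <-.
by rewrite 2!mxE; apply: eq_bigr => j _; rewrite !mxE.
Qed.

Lemma D_orthD : (D x :&: orthD = 0)%MS.
Proof.
apply/eqP/rowV0P => u; rewrite sub_capmx => /andP[uD /sub_orthP uo].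
exact: (@g_self0 x) (uo _ uD).
Qed.

(** By dimension: the Gram matrix being invertible, the orthogonal complement
    has codimension the rank of the distribution. *)
Lemma D_add_orthD u : (u <= D x + orthD)%MS.
Proof.
apply: submx_full; rewrite /row_full.
have -> : \rank (D x + orthD)%MS = (\rank (D x) + \rank orthD)%N.
  by rewrite mxrank_disjoint_sum // D_orthD.
rewrite mxrank_ker -(mxrank_tr (gram x *m _)) trmx_mul trmxK mxrankMfree.
  by rewrite subnKC // rank_leq_col.
by rewrite row_free_unit unitmx_tr gram_unit.
Qed.

Lemma projD_lin (a : R) u v : P (a *: u + v) = a *: P u + P v.
Proof. by rewrite /projD mulmxDl scalemxAl. Qed.

Lemma projD_sub u : (P u <= D x)%MS.
Proof. exact: proj_mx_sub. Qed.

Lemma projD_id u : (u <= D x)%MS -> P u = u.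
Proof. by apply: proj_mx_id; apply: D_orthD. Qed.

Lemma projDK u : P (P u) = P u.
Proof. by rewrite projD_id // projD_sub. Qed.

Lemma projD_compl u w : (w <= D x)%MS -> g x (u - P u) w = 0.
Proof.
by move=> wD; apply/(sub_orthP _): w wD; apply: proj_mx_compl_sub; apply: D_add_orthD.
Qed.

Lemma projD_unique u p : (p <= D x)%MS ->
  (forall w, (w <= D x)%MS -> g x (u - p) w = 0) -> P u = p.
Proof.
move=> pD /sub_orthP up; rewrite -[u in P u](subrK p) /projD mulmxDl.
by rewrite [X in X + _]proj_mx_0 ?D_orthD // add0r; apply: projD_id.
Qed.

Lemma projD_sym u v : g x (P u) v = g x u (P v).
Proof.
have e u' v' : g x u' (P v') = g x (P u') (P v').
  apply/eqP; rewrite -subr_eq0 -(hermN hg) -(hermD hg) projD_compl ?projD_sub //.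
by rewrite e gC e gC.
Qed.

Lemma projD_J u : P (Jop x u) = Jop x (P u).
Proof.
have JDw w : (w <= D x)%MS -> (Jop x w <= D x)%MS.
  by move=> wD; apply: submx_trans stD; apply: submxMr.
apply: projD_unique; first by apply: JDw; apply: projD_sub.
move=> w wD; rewrite -(linmapN (@Jop_lin x)) -(linmapD (@Jop_lin x)).
have := hermJr (JopK x) hg (u - P u) w; rewrite projD_compl ?JDw // => /esym/eqP.
by rewrite oppr_eq0 => /eqP.
Qed.

(** A unit vector [e] of the distribution and its rotation [Je] are an
    orthonormal basis of it. *)
Lemma D_basis e u : (e <= D x)%MS -> g x e e = 1 ->
  P u = g x u e *: e + g x u (Jop x e) *: Jop x e.
Proof.
move=> eD ee.
have eJe : g x (Jop x e) e = 0 by apply: hermJ_self (JopK x) hg e.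
have Jee : g x e (Jop x e) = 0 by rewrite gC.
have JJ1 : g x (Jop x e) (Jop x e) = 1 by rewrite (herm_J hg).
have JeD : (Jop x e <= D x)%MS by apply: submx_trans stD; apply: submxMr.
pose M := col_mx e (Jop x e).
have MD : (M <= D x)%MS by rewrite col_mx_sub eD JeD.
have rkM : \rank M = 2%N by apply: rank_complex_line.
have DM : (D x <= M)%MS.
  by rewrite -(mxrank_leqif_sup MD).2 rkM rkD.
apply: projD_unique; first by rewrite addmx_sub // scalemx_sub.
move=> w /submx_trans /(_ DM) /submxP [c ->].
rewrite -[c]hsubmxK mul_row_col [lsubmx c]mx11_scalar [rsubmx c]mx11_scalar.
rewrite !mul_scalar_mx !(hermDr hg) !(hermZr hg) !(hermD hg) !(hermN hg).
rewrite !(hermD hg) !(hermZ hg) ee JJ1 eJe Jee.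
by ring.
Qed.

End AtPoint.
End Pointwise.

(** * The curvature identity at a point *)

Section Main.
Context {R : realType} {n : nat} {K : kahler R n}.
Local Notation TM := 'rV[R]_(2 * n).
Variable D : K -> 'M[R]_(2 * n).

Section AtPoint.
Variable x : K.
Hypothesis rkD : \rank (D x) = 2%N.
Hypothesis stD : stablemx (D x) (J x).
Local Notation P := (projD D x).
Local Notation j := (Jop x).
Local Notation hD := (restriction P (g x)).
Let hg := g_hermitian x.
Let hh := hermitian_restriction hg (projD_lin D x) (projD_J stD).
Let PP := projDK D x.
Let gP := projD_sym D x.
Let kT := Rm_kaehler_curvature x.

Lemma PiE X Y Z U : Pi x X Y Z U = mixed_curvature j (g x) (g x) X Y Z U.
Proof.
rewrite /Pi /mixed_curvature /= /Jop.
by field.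
Qed.

Lemma PhiE X Y Z U : Phi D x X Y Z U = mixed_curvature j (g x) hD X Y Z U.
Proof. by []. Qed.

Lemma PsiE X Y Z U : Psi D x X Y Z U = square_curvature j hD X Y Z U.
Proof. by []. Qed.

(** The difference of the two sides is the action on R of S = R - (a + b/2) Pi,
    whose endomorphisms [L] preserve the metric, the complex structure and the
    distribution. *)
Lemma act_pseudosymmetric (a b c : R) :
  (forall X Y Z U, Rm x X Y Z U = a * Pi x X Y Z U + b * Phi D x X Y Z U + c * Psi D x X Y Z U) ->
  forall U V X1 X2 X3 X4,
    act (@Rm R n K) (@Rm R n K) x U V X1 X2 X3 X4 =
    (a + b / 2) * act (@Pi R n K) (@Rm R n K) x U V X1 X2 X3 X4.
Proof.
move=> RE U V X1 X2 X3 X4; set f := a + b / 2.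
pose L X := endo (@Rm R n K) x U V X - f *: endo (@Pi R n K) x U V X.
have Tl := kcE kT.
have gL X W : g x (L X) W = split_curvature j P (g x) b c U V X W.
  rewrite /L (hermD hg) (hermN hg) (hermZ hg) !endoE.
  - by rewrite RE PhiE PsiE PiE /split_curvature /f; field.
  - move=> s u v; rewrite !PiE.
    have k1 := mixed_kaehler_curvature (@Jop_lin _ _ _ x) (JopK x) hg hg.
    by rewrite (kcD4 k1) (kcZ4 k1).
  - by move=> s u v; rewrite (kcD4 kT) (kcZ4 kT).
have Pl := projD_lin D x; have PJ := projD_J stD.
have Lg X Y : g x (L X) Y = - g x X (L Y).
  by rewrite gL (herm_sym hg X) gL; apply: split_curvature_skew (JopK x) hg Pl PJ _ _ _ _ _ _.
have hL X Y : hD (L X) Y = split_curvature j P (g x) b c U V X (P Y).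
  by rewrite (restrictionE PP gP (L X)) gP gL.
have Lh X Y : hD (L X) Y = - hD X (L Y).
  rewrite (herm_sym hh X) !hL.
  exact: split_curvature_P (JopK x) hg Pl PP PJ gP _ _ _ _ _ _.
have LgJ X Y : g x (j (L X)) Y = - g x (j X) (L Y).
  rewrite (herm_sym hg (j X)) gL -[LHS]opprK -(hermJr (JopK x) hg) gL.
  by congr (- _); apply: split_curvature_J (JopK x) hg Pl PJ _ _ _ _ _ _.
have LhJ X Y : hD (j (L X)) Y = - hD (j X) (L Y).
  rewrite (herm_sym hh (j X)) -[LHS]opprK -(hermJr (JopK x) hh).
  rewrite !hL; congr (- _).
  exact: split_curvature_PJ (JopK x) hg Pl PP PJ gP _ _ _ _ _ _.
have d0 : derivation L (Rm x) X1 X2 X3 X4 = 0.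
  have dgg := mixed_derivation Lg Lg LgJ LgJ X1 X2 X3 X4.
  have dgh := mixed_derivation Lg Lh LgJ LhJ X1 X2 X3 X4.
  have dhh := square_derivation LhJ X1 X2 X3 X4.
  clearbody L; transitivity (a * derivation L (mixed_curvature j (g x) (g x)) X1 X2 X3 X4 +
      b * derivation L (mixed_curvature j (g x) hD) X1 X2 X3 X4 +
      c * derivation L (square_curvature j hD) X1 X2 X3 X4).
    rewrite /derivation !RE !PiE !PhiE !PsiE.
    by ring.
  by rewrite dgg dgh dhh !mulr0 !addr0.
apply/eqP; rewrite -subr_eq0; apply/eqP; rewrite -[RHS]oppr0 -d0.
rewrite /derivation /L !Tl /act.
generalize (Rm x (endo (@Rm R n K) x U V X1) X2 X3 X4) (Rm x X1 (endo (@Rm R n K) x U V X2) X3 X4)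
  (Rm x X1 X2 (endo (@Rm R n K) x U V X3) X4) (Rm x X1 X2 X3 (endo (@Rm R n K) x U V X4))
  (Rm x (endo (@Pi R n K) x U V X1) X2 X3 X4) (Rm x X1 (endo (@Pi R n K) x U V X2) X3 X4)
  (Rm x X1 X2 (endo (@Pi R n K) x U V X3) X4) (Rm x X1 X2 X3 (endo (@Pi R n K) x U V X4)) => *.
by ring.
Qed.

Lemma exists_unit_D : exists2 e : TM, (e <= D x)%MS & g x e e = 1.
Proof.
have D0 : D x != 0 by rewrite -mxrank_eq0 rkD.
pose v := nz_row (D x); have v0 : v != 0 by rewrite nz_row_eq0.
have [s [_ _ s1]] := herm_normalize hg (g_pos x v0).
by exists (s^-1 *: v) => //; rewrite scalemx_sub // nz_row_sub.
Qed.

Lemma exists_notin_D : (2 * n != 2)%N -> exists v : TM, ~~ (v <= D x)%MS.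
Proof.
move=> n1; suff : ~~ (1%:M <= D x)%MS by move=> /row_subPn [i]; exists (row i 1%:M).
by rewrite sub1mx /row_full rkD eq_sym.
Qed.

Lemma exists_unit_orthD : (2 * n != 2)%N -> exists2 e : TM, P e = 0 & g x e e = 1.
Proof.
move=> /exists_notin_D [u uD]; pose v := u - P u.
have Pv : P v = 0 by rewrite (linmapD (projD_lin D x)) (linmapN (projD_lin D x)) PP subrr.
have v0 : v != 0.
  by apply: contraNneq uD => /subr0_eq ->; apply: projD_sub.
have [s [_ _ s1]] := herm_normalize hg (g_pos x v0).
by exists (s^-1 *: v) => //; rewrite (linmapZ (projD_lin D x)) Pv scaler0.
Qed.

(** In an orthonormal basis (e, Je) of the distribution, the 2-form is the
    determinant of the coordinates of the projections: a decomposable form. *)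
Lemma omega_decomposable X Y Z U : hD (j X) Y * hD (j Z) U +
  hD (j Y) Z * hD (j X) U + hD (j Z) X * hD (j Y) U = 0.
Proof.
have [e eD ee] := exists_unit_D.
have eJe : g x (j e) e = 0 by apply: hermJ_self (JopK x) hg e.
have Jee : g x e (j e) = 0 by rewrite gC.
have JJ1 : g x (j e) (j e) = 1 by rewrite (herm_J hg).
have o u v : hD (j u) v = g x u e * g x v (j e) - g x u (j e) * g x v e.
  rewrite /restriction !(D_basis rkD stD _ eD ee).
  rewrite !(hermD hg) !(hermDr hg) !(hermZ hg) !(hermZr hg) ee eJe Jee JJ1.
  by rewrite (herm_J hg) -[g x (j u) e]opprK -(hermJr (JopK x) hg); ring.
by rewrite !o; ring.
Qed.

Variable phi : R -> R.
Hypothesis Tphi : forall pi : 'M[R]_(2 * n), \rank pi = 2%N -> stablemx pi (J x) ->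
  forall X : TM, (X <= pi)%MS -> g x X X = 1 ->
  Rm x X (X *m J x) (X *m J x) X = phi (Num.sqrt (g x (X *m pD D x) (X *m pD D x))).

Lemma holomorphic_phi X : g x X X = 1 ->
  holomorphic j (Rm x) X = phi (Num.sqrt (hD X X)).
Proof.
have sX : (X <= col_mx X (j X))%MS by rewrite -addsmxE addsmxSl.
have sJX : (j X <= col_mx X (j X))%MS by rewrite -addsmxE addsmxSr.
move=> X1; apply: (Tphi (pi := <<col_mx X (j X)>>%MS)) => //.
- by rewrite mxrank_gen rank_complex_line.
- rewrite (eqmxMr (J x) (genmxE _)) genmxE mul_col_mx col_mx_sub sJX /=.
  by rewrite -/(j (j X)) JopK eqmx_opp.
- by rewrite genmxE.
Qed.

(** If the distribution is the whole tangent space, a curvature c Psi fits; a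
    and b are then not determined, and are chosen to be 0 so that a + b/2 is a
    smooth function of the point. *)
Lemma exists_qch_coefficients : exists a b c : R,
  ((2 * n)%N = 2%N -> a + b / 2 = 0) /\ forall X Y Z U, Rm x X Y Z U =
    a * Pi x X Y Z U + b * Phi D x X Y Z U + c * Psi D x X Y Z U.
Proof.
have jl := @Jop_lin _ _ K x; have jK := JopK x; have gp := @g_pos _ _ K x.
have Pl := projD_lin D x; have PJ := projD_J stD.
suff [a [b [c [nab Habc]]]] : exists a b c : R,
    ((2 * n)%N = 2%N -> a + b / 2 = 0) /\ forall X, holomorphic j (Rm x) X =
      a * g x X X ^+ 2 + b * (g x X X * hD X X) + c * hD X X ^+ 2.
  exists a, b, c; split=> // X Y Z U.
  rewrite (qch_modelP jl jK hg Pl PJ kT omega_decomposable Habc).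
  by rewrite /qch_model PiE PhiE PsiE; ring.
have [n1|n1] := eqVneq (2 * n)%N 2%N.
  exists 0, 0, (phi 1); split; first by rewrite mul0r addr0.
  apply: (holomorphic_full jl hg gp Pl PJ kT holomorphic_phi) => X.
  by apply: projD_id; apply: submx_full; rewrite /row_full rkD n1.
have [e1 e1D g1] := exists_unit_D; have [e2 Pe2 g2] := exists_unit_orthD n1.
have [a [b [c H]]] := holomorphic_split jl hg gp Pl PP PJ gP kT holomorphic_phi
  (projD_id e1D) Pe2 g1 g2.
by exists a, b, c; split=> // e; rewrite e eqxx in n1.
Qed.

End AtPoint.
End Main.

(** * Smoothness of the coefficient *)

Section Smoothness.
Context {R : realType} {n : nat} {K : kahler R n}.
Local Notation TM := 'rV[R]_(2 * n).
Variable D : K -> 'M[R]_(2 * n).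

Lemma D_basis_scaled x e u : \rank (D x) = 2%N -> stablemx (D x) (J x) ->
  (e <= D x)%MS ->
  g x e e *: projD D x u = g x u e *: e + g x u (Jop x e) *: Jop x e.
Proof.
move=> rkD stD eD; have hg := g_hermitian x.
have [->|e0] := eqVneq e 0.
  by rewrite (linmap0 (@Jop_lin _ _ _ x)) (herm0 hg) !scale0r !scaler0 addr0.
have [s [s0 ss]] := herm_normalize hg (g_pos x e0); set e' := s^-1 *: e => e'1.
have eE : e = s *: e' by rewrite scalerA divff // scale1r.
have e'D : (e' <= D x)%MS by rewrite scalemx_sub.
clearbody e'; rewrite (D_basis rkD stD u e'D e'1) -ss eE (linmapZ (@Jop_lin _ _ _ x)).
rewrite !(hermZr hg) scalerDr !scalerA.
by congr (_ *: _ + _ *: _); ring.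
Qed.

Lemma smooth_holomorphic (X : vfield K) : smooth_vfield X ->
  smooth (fun y => holomorphic (Jop y) (Rm y) (X y)).
Proof.
move=> sX; have sJX := J_smooth sX.
have eq y : holomorphic (Jop y) (Rm y) (X y) =
    g y (curvature_vfield X (fun z => X z *m J z) (fun z => X z *m J z) y) (X y).
  by rewrite -RmE.
rewrite (_ : (fun y => _) = fun y => g y (curvature_vfield X (fun z => X z *m J z)
   (fun z => X z *m J z) y) (X y)); last by apply/funext.
have sB := smooth_nabla (smooth_bracket sX sJX) sJX.
have sXX := smooth_nabla sX (smooth_nabla sJX sJX).
have sJJ := smooth_nabla sJX (smooth_nabla sX sJX).
exact: smooth_g (smooth_vfieldB (smooth_vfieldB sXX sJJ) sB) sX.
Qed.

(** The curvature of R on X is a |X|^4 + b |X|^2 |PX|^2 + c |PX|^4; the last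
    term does not contribute because the projection of e1 + e2 is that of e1. *)
Lemma holomorphic_cross_term x (a b c : R) e1 e2 :
  \rank (D x) = 2%N -> stablemx (D x) (J x) ->
  (forall X Y Z U, Rm x X Y Z U =
     a * Pi x X Y Z U + b * Phi D x X Y Z U + c * Psi D x X Y Z U) ->
  projD D x e1 = e1 -> projD D x e2 = 0 ->
  holomorphic (Jop x) (Rm x) (e1 + e2) - holomorphic (Jop x) (Rm x) e1 -
    holomorphic (Jop x) (Rm x) e2 = (a + b / 2) * (2 * (g x e1 e1 * g x e2 e2)).
Proof.
move=> rkD stD RE P1 P2; have hg := g_hermitian x; have jK := JopK x.
have hh := hermitian_restriction hg (projD_lin D x) (projD_J stD).
have H X : holomorphic (Jop x) (Rm x) X = a * (g x X X * g x X X) +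
    b * (g x X X * restriction (projD D x) (g x) X X) +
    c * restriction (projD D x) (g x) X X ^+ 2.
  rewrite /holomorphic RE PiE PhiE PsiE.
  by rewrite (mixed_holomorphic jK hg hg) (mixed_holomorphic jK hg hh) (square_holomorphic jK hh).
have g12 : g x e1 e2 = 0 by rewrite -P1 projD_sym P2 gC (herm0 hg).
have g21 : g x e2 e1 = 0 by rewrite gC.
rewrite !H /restriction (linmapD (projD_lin D x)) P1 P2 addr0.
rewrite !(hermD hg) !(hermDr hg) (herm0 hg) g12 g21.
by field.
Qed.

Hypothesis DD : smooth_rank2_distribution D.
Hypothesis stD : forall x, stablemx (D x) (J x).

(** The two frame fields cannot both vanish at [x], where they span a plane. *)
Lemma exists_section x : exists e : vfield K,
  [/\ smooth_vfield e, e x != 0 & \forall y \near x, (e y <= D y)%MS].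
Proof.
have [rkD /(_ x) [E1 [E2 [s1 s2 E12]]]] := DD.
have near_sub : \forall y \near x, (E1 y <= D y)%MS /\ (E2 y <= D y)%MS.
  apply: filterS E12 => y /andP[_]; rewrite col_mx_sub => /andP[h1 h2].
  by split.
have [E1x|E1x] := eqVneq (E1 x) 0; last first.
  by exists E1; split=> //; apply: filterS near_sub => y [].
exists E2; split=> //; last by apply: filterS near_sub => y [].
apply/eqP => E2x; have /eqmxP D12 := nbhs_singleton E12.
by have := rkD x; rewrite D12 E1x E2x col_mx0 mxrank0.
Qed.

(** With e1 a local section of the distribution and v any field transverse to it
    at the point, the field e2 below is |e1|^2 times the orthogonal component of
    v: scaling by |e1|^2 spares a division, and keeps the identity valid where
    e1 vanishes. *)
Lemma smooth_coefficient (a b c : K -> R) :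
  (forall x X Y Z U, Rm x X Y Z U =
     a x * Pi x X Y Z U + b x * Phi D x X Y Z U + c x * Psi D x X Y Z U) ->
  (2 * n != 2)%N -> smooth (fun x => a x + b x / 2).
Proof.
move=> RE n1; have [rkD _] := DD; apply: smooth_local_quotient => x.
have [e1 [s1 e1x e1D]] := exists_section x.
have [v0 v0D] := exists_notin_D (rkD x) n1.
have [sv vx] := @extensionP R _ K x v0; set v := extension x v0 in sv vx.
have sJ1 := J_smooth s1.
pose e2 : vfield K := fun y => g y (e1 y) (e1 y) *: v y -
  (g y (v y) (e1 y) *: e1 y + g y (v y) (e1 y *m J y) *: (e1 y *m J y)).
have s2 : smooth_vfield e2.
  apply: smooth_vfieldB; first by apply: smooth_vfieldZ => //; apply: smooth_g.
  by apply: smooth_vfieldD; apply: smooth_vfieldZ => //; apply: smooth_g.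
have s12 := smooth_vfieldD s1 s2.
pose H (X : vfield K) y := holomorphic (Jop y) (Rm y) (X y).
exists (fun y => H (fun z => e1 z + e2 z) y - H e1 y - H e2 y),
  (fun y => 2 * (g y (e1 y) (e1 y) * g y (e2 y) (e2 y))); split.
- by apply: smoothB; [apply: smoothB|]; apply: smooth_holomorphic.
- by apply: smoothM; [apply: smooth_cst|apply: smoothM; apply: smooth_g].
- have e2x : e2 x != 0.
    apply: contraNneq v0D => /subr0_eq e.
    rewrite -vx -[v x](scalerK (a := g x (e1 x) (e1 x))); last by rewrite gt_eqF // g_pos.
    have eD := nbhs_singleton e1D.
    rewrite scalemx_sub // e addmx_sub // scalemx_sub //.
    by apply: submx_trans (stD x); apply: submxMr.
  by rewrite !mulf_neq0 // gt_eqF ?g_pos.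
apply: filterS e1D => y eD; apply/esym.
apply: holomorphic_cross_term => //.
- exact: projD_id.
have Pl := projD_lin D y.
rewrite /e2 (linmapD Pl) (linmapN Pl) (linmapZ Pl) (D_basis_scaled _ (rkD y) (stD y) eD).
rewrite [X in - X]projD_id ?subrr // addmx_sub // scalemx_sub //.
by apply: submx_trans (stD y); apply: submxMr.
Qed.

End Smoothness.

Theorem theorem1 (R : realType) (n : nat) (K : kahler R n)
    (D : K -> 'M[R]_(2 * n)) :
  QCH D ->
  holomorphically_pseudosymmetric K /\
  forall a b c : K -> R, smooth a -> smooth b -> smooth c ->
    (forall x X Y Z U,
       Rm x X Y Z U =
       a x * Pi x X Y Z U + b x * Phi D x X Y Z U + c x * Psi D x X Y Z U) ->
    forall x U V X1 X2 X3 X4,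
      act (@Rm R n K) (@Rm R n K) x U V X1 X2 X3 X4 =
      (a x + b x / 2) * act (@Pi R n K) (@Rm R n K) x U V X1 X2 X3 X4.
Proof.
move=> [DD stD [phi Hphi]]; have [rkD _] := DD.
split; last by move=> a b c _ _ _ RE x; apply: (act_pseudosymmetric (stD x) (RE x)).
have /choice[k Hk] x : exists k : R * R * R,
    ((2 * n)%N = 2%N -> k.1.1 + k.1.2 / 2 = 0) /\
    forall X Y Z U, Rm x X Y Z U = k.1.1 * Pi x X Y Z U +
      k.1.2 * Phi D x X Y Z U + k.2 * Psi D x X Y Z U.
  have [a [b [c abc]]] := exists_qch_coefficients (rkD x) (stD x) (Hphi x).
  by exists (a, b, c).
exists (fun x => (k x).1.1 + (k x).1.2 / 2).
  have [n1|n1] := eqVneq (2 * n)%N 2%N.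
    rewrite (_ : (fun x => _) = fun=> 0); first exact: smooth_cst.
    by apply/funext => x; apply: (Hk x).1.
  exact: (smooth_coefficient DD stD (fun x => (Hk x).2) n1).
by move=> x; apply: (act_pseudosymmetric (stD x) (Hk x).2).
Qed.
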